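(* Let $T\in\mathbb{B}(\mathcal{H})$ be centered with the polar decomposition $T=U|T|$ and let $\lambda\in(0,1)$. If $T$ is semi-hyponormal, then there exists a positive operator $L\in\mathbb{B}(\mathcal{H})$ such that $\lim_{n\to\infty}P_{\lambda}^{(n)}(T)=UL$ in the strong operator topology. Moreover, $UL$ is quasinormal and $\|UL\|=\|P_{\lambda}^{(n)}(T)\|$ for all $n\in\mathbb{N}=\{0,1,2,\dots\}$.
   Context: $\mathbb{B}(\mathcal{H})$ denotes the bounded linear operators on a complex Hilbert space $\mathcal{H}$; $[A,B]=AB-BA$. $T$ is centered if $[T^n(T^n)^{*},(T^m)^{*}T^m]=0$ for all $n,m\in\{1,2,\dots\}$; semi-hyponormal if $(T^{*}T)^{1/2}\ge(TT^{*})^{1/2}$; quasinormal if $[T,T^{*}T]=0$. The polar decomposition of $T$ is the unique factorization $T=U|T|$, where $|T|=(T^{*}T)^{1/2}$ and $U$ is a partial isometry with $\mathcal{N}(U)=\mathcal{N}(T)$. The Duggal transform is $T^{D}=|T|U$, the Aluthge transform is $\Delta(T)=|T|^{1/2}U|T|^{1/2}$, and the power mean transform is $P_{\lambda}(T)=(1-\lambda)^2T+\lambda^2T^{D}+2\lambda(1-\lambda)\Delta(T)$. Its iterates are $P_{\lambda}^{(0)}(T)=T$ and $P_{\lambda}^{(n)}(T)=P_{\lambda}\big(P_{\lambda}^{(n-1)}(T)\big)$ for $n\ge1$. *)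

(* Defs.v *)
From HB Require Import structures.
From mathcomp Require Import all_boot all_order all_algebra.
From mathcomp Require Import complex.
From mathcomp Require Import all_classical all_reals all_analysis.

Set Implicit Arguments.
Unset Strict Implicit.
Unset Printing Implicit Defensive.

Import Order.TTheory GRing.Theory Num.Theory.
Import numFieldNormedType.Exports.

Local Open Scope classical_set_scope.
Local Open Scope complex_scope.
Local Open Scope ring_scope.

(* The inner product is linear in its first argument and conjugate-linear in
   the second.  The norm of H takes its values in R[i], where 0 <= z means that
   z is real and nonnegative. *)
HB.mixin Record isHilbert (R : realType) H of CompleteNormedModule R[i] H := {
  inner : {dot H for Num.conj};
  normr_inner : forall x : H, `|x| ^+ 2 = inner x x
}.

#[short(type="hilbertType")]
HB.structure Definition Hilbert (R : realType) :=
  { H of isHilbert R H & CompleteNormedModule R[i] H }.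

Section Operators.
Variables (R : realType) (H : hilbertType R).

(* Operators are functions H -> H satisfying [bounded_op]; sums, scalar
   multiples and 0 are the pointwise ones, the product is composition. *)
Implicit Types A B T U : H -> H.

Definition bounded_op T :=
  linear T /\ exists M : R, forall x, `|T x| <= M%:C * `|x|.

Definition opnorm T : R :=
  sup [set complex.Re `|T x| | x in [set x : H | `|x| <= 1]].

(* [\o] and [-] have the same precedence, hence the parentheses. *)
Definition commutator A B : H -> H := (A \o B) - (B \o A).

(* The adjoint, the positive square root and the partial isometry of the polar
   decomposition exist and are unique whenever they make sense; [xget] picks
   them and returns the default 0 only when there is none. *)
Definition adjoint T : H -> H :=
  xget 0 [set S : H -> H | bounded_op S /\
    forall x y, inner (T x) y = inner x (S y)].

Definition positive_op T := bounded_op T /\ forall x, 0 <= inner (T x) x.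

Definition op_le A B := positive_op (B - A).

Definition op_sqrt A : H -> H :=
  xget 0 [set S : H -> H | positive_op S /\ S \o S = A].

Definition op_abs T : H -> H := op_sqrt (adjoint T \o T).

(* U is isometric on the orthogonal complement of its kernel. *)
Definition partial_isometry U := bounded_op U /\
  forall x, (forall y, U y = 0 -> inner x y = 0) -> `|U x| = `|x|.

Definition polar_decomposition T U :=
  [/\ partial_isometry U, T = U \o op_abs T & forall x, U x = 0 <-> T x = 0].

Definition polar_part T : H -> H :=
  xget 0 [set U : H -> H | polar_decomposition T U].

Definition centered T := forall n m : nat, (0 < n)%N -> (0 < m)%N ->
  commutator (iter n T \o adjoint (iter n T))
             (adjoint (iter m T) \o iter m T) = 0.

Definition semi_hyponormal T :=
  op_le (op_sqrt (T \o adjoint T)) (op_sqrt (adjoint T \o T)).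

Definition quasinormal T := commutator T (adjoint T \o T) = 0.

Definition duggal T : H -> H := op_abs T \o polar_part T.

Definition aluthge T : H -> H :=
  op_sqrt (op_abs T) \o polar_part T \o op_sqrt (op_abs T).

Definition power_mean (lambda : R) T : H -> H :=
  ((1 - lambda) ^+ 2)%:C *: T + (lambda ^+ 2)%:C *: duggal T
  + (2 * lambda * (1 - lambda))%:C *: aluthge T.

Definition sot_cvg (S : nat -> H -> H) T :=
  forall x, S n x @[n --> \oo] --> T x.

End Operators.

(* Main.v *)
(* Write P = |T|, A = P^(1/2), E = U U^* and phi(X) = U^* X U.  For a centered
   T the operators phi^k(P^2) commute with each other and with E: the products
   T^*^m T^m commute mutually and with T T^*, they factor as P^2 phi(P^2) ...
   phi^(m-1)(P^2), and one factor after the other is cancelled along increasing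
   kernels.  On operators commuting with E the map phi is multiplicative, so
   the phi^k(A) commute as well, and the transform of U X^2 is U Y^2 with
   Y = (1 - lambda) X + lambda phi(X); the partial isometry never changes.

   Semi-hyponormality says P <= phi(P), whence A <= phi(A) by Loewner-Heinz.
   Therefore the square roots A_n of the moduli of the iterates increase, and
   they stay below the constant a = norm of A.  They converge strongly to some B
   with phi(B) = B; since B commutes with E this means U B = B U.  The limit of
   the iterates is U B^2, which is quasinormal, and A <= A_n <= B <= a shows
   that all the norms equal a^2. *)

From HB Require Import structures.
From mathcomp Require Import all_boot all_order all_algebra.
From mathcomp Require Import complex.
From mathcomp Require Import all_classical all_reals all_analysis.
From mathcomp Require Import ring lra.
Require Import Defs.

Set Implicit Arguments.
Unset Strict Implicit.
Unset Printing Implicit Defensive.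

Import Order.TTheory GRing.Theory Num.Theory.
Import numFieldNormedType.Exports.

Local Open Scope complex_scope.
Local Open Scope ring_scope.

(** * Real parts of complex numbers *)

Lemma ReD (R : realType) (a b : R[i]) : complex.Re (a + b) = complex.Re a + complex.Re b.
Proof. by case: a b => [? ?] [? ?]. Qed.

Lemma ReN (R : realType) (a : R[i]) : complex.Re (- a) = - complex.Re a.
Proof. by case: a. Qed.

Lemma ReZ (R : realType) (r : R) (a : R[i]) : complex.Re (r%:C * a) = r * complex.Re a.
Proof. by case: a => a b /=; rewrite mul0r subr0. Qed.

(** * The underlying real inner product space *)

Section RealInner.
Variables (R : realType) (H : hilbertType R).
Implicit Types (x y z : H) (r : R).

(** Estimates are carried out over the ordered field [R]; by [innerE] the real part of the inner
    product determines all of it. *)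
Definition rin x y : R := complex.Re (inner x y).
Definition nr x : R := complex.Re `|x|.

Lemma innerDl x y z : inner (x + y) z = inner x z + inner y z.
Proof. exact: (linearDl inner). Qed.

Lemma innerDr x y z : inner z (x + y) = inner z x + inner z y.
Proof. exact: (linearDr inner). Qed.

Lemma innerZl (c : R[i]) x z : inner (c *: x) z = c * inner x z.
Proof. exact: (linearZl_LR inner). Qed.

Lemma innerZr (c : R[i]) x z : inner z (c *: x) = c^*%C * inner z x.
Proof. exact: (linearZr_LR inner). Qed.

Lemma rinC x y : rin x y = rin y x.
Proof. by rewrite /rin (hermC inner) expr0 mul1r /=; case: (inner y x). Qed.

Lemma rinDl x y z : rin (x + y) z = rin x z + rin y z.
Proof. by rewrite /rin (linearDl inner) ReD. Qed.

Lemma rinNl x z : rin (- x) z = - rin x z.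
Proof. by rewrite /rin (linearNl inner) ReN. Qed.

Lemma rinBl x y z : rin (x - y) z = rin x z - rin y z.
Proof. by rewrite rinDl rinNl. Qed.

Lemma rinZl r x z : rin (r%:C *: x) z = r * rin x z.
Proof. by rewrite /rin (linearZl_LR inner) ReZ. Qed.

Lemma rin0l z : rin 0 z = 0.
Proof. by rewrite /rin (linear0l inner). Qed.

Lemma rinDr x y z : rin z (x + y) = rin z x + rin z y.
Proof. by rewrite rinC rinDl !(rinC z). Qed.

Lemma rinNr x z : rin z (- x) = - rin z x.
Proof. by rewrite rinC rinNl !(rinC z). Qed.

Lemma rinBr x y z : rin z (x - y) = rin z x - rin z y.
Proof. by rewrite rinC rinBl !(rinC z). Qed.

Lemma rinZr r x z : rin z (r%:C *: x) = r * rin z x.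
Proof. by rewrite rinC rinZl !(rinC z). Qed.

Lemma rin0r z : rin z 0 = 0.
Proof. by rewrite rinC rin0l. Qed.

(** Conjugate-linearity in the second argument turns Im <x, y> into Re <x, i y>. *)
Lemma innerE x y : inner x y = (rin x y) +i* (rin x ('i *: y)).
Proof.
rewrite [rin x ('i *: y)]/rin (linearZr_LR inner) /=.
by case E: (inner x y) => [a b]; rewrite /rin E /=; congr (_ +i* _); ring.
Qed.

Lemma rin_ii x y : rin ('i *: x) ('i *: y) = rin x y.
Proof.
rewrite /rin (linearZl_LR inner) /= (linearZr_LR inner) /=.
by case: (inner x y) => [a b] /=; ring.
Qed.

Lemma rin_i x y : rin ('i *: x) y = - rin x ('i *: y).
Proof.
by rewrite -(rin_ii ('i *: x)) scalerA -expr2 sqr_i scaleN1r rinNl.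
Qed.

Lemma normE x : `|x| = (nr x)%:C.
Proof. by rewrite /nr RRe_real // ger0_real. Qed.

Lemma nr_ge0 x : 0 <= nr x.
Proof. by rewrite -ler0c -normE. Qed.

Lemma rinxx x : rin x x = nr x ^+ 2.
Proof. by rewrite /rin -normr_inner normE -rmorphXn. Qed.

Lemma nr_eq0 x : nr x = 0 -> x = 0.
Proof. by move=> h; apply/eqP; rewrite -normr_eq0 normE h. Qed.

Lemma nr0 : nr 0 = 0.
Proof. by rewrite /nr normr0. Qed.

Lemma rinxx_ge0 x : 0 <= rin x x.
Proof. by rewrite rinxx sqr_ge0. Qed.

Lemma rinxx_eq0 x : rin x x = 0 -> x = 0.
Proof. by rewrite rinxx => /eqP; rewrite expf_eq0 /= => /eqP/nr_eq0. Qed.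

Lemma rin_eq0 x : (forall y, rin x y = 0) -> x = 0.
Proof. by move=> /(_ x)/rinxx_eq0. Qed.

Lemma rin_inj x y : (forall z, rin x z = rin y z) -> x = y.
Proof.
by move=> h; apply/eqP; rewrite -subr_eq0; apply/eqP/rin_eq0 => z; rewrite rinBl h subrr.
Qed.

Lemma nrD x y : nr (x + y) <= nr x + nr y.
Proof. by rewrite -lecR rmorphD /= -!normE; exact: ler_normD. Qed.

Lemma nrN x : nr (- x) = nr x.
Proof. by rewrite /nr normrN. Qed.

Lemma nrZ r x : nr (r%:C *: x) = `|r| * nr x.
Proof. by rewrite /nr normrZ normc_def /= expr0n /= addr0 sqrtr_sqr ReZ. Qed.

(** Cauchy-Schwarz, from expanding the square of |y| x - |x| y; the cases x = 0 and y = 0 are split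
    off because the expansion is divided by |x| |y|. *)
Lemma rin_le x y : rin x y <= nr x * nr y.
Proof.
have [y0|y0] := eqVneq (nr y) 0.
  by rewrite (nr_eq0 y0) rin0r nr0 mulr0.
have yp : 0 < nr y by rewrite lt_neqAle eq_sym y0 nr_ge0.
have [x0|x0] := eqVneq (nr x) 0.
  by rewrite (nr_eq0 x0) rin0l nr0 mul0r.
have xp : 0 < nr x by rewrite lt_neqAle eq_sym x0 nr_ge0.
have := rinxx_ge0 ((nr y)%:C *: x - (nr x)%:C *: y).
rewrite !(rinBl, rinBr, rinZl, rinZr) (rinC y x) !rinxx => h.
have : 0 <= (2 * (nr x * nr y)) * (nr x * nr y - rin x y) by nra.
by rewrite pmulr_rge0 ?subr_ge0 // !mulr_gt0.
Qed.

Lemma rin_abs_le x y : `|rin x y| <= nr x * nr y.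
Proof.
rewrite ler_norml lerNl rin_le andbT -rinNl.
by apply: (le_trans (rin_le _ _)); rewrite nrN.
Qed.

End RealInner.

(** * Norm convergence of sequences with real radii *)

Section Convergence.
Variables (R : realType) (H : hilbertType R).
Implicit Types (u v : nat -> H) (x y z l : H).

Definition hcvg u l := forall e : R, 0 < e ->
  exists N, forall n, (N <= n)%N -> nr (u n - l) < e.

Lemma hcvgP u l : (u n @[n --> \oo] --> l)%classic <-> hcvg u l.
Proof.
rewrite cvgrPdist_lt; split => h.
  move=> e e0; have /h [N _ hN] : 0 < e%:C by rewrite ltcR.
  by exists N => n /hN /=; rewrite distrC normE ltcR.
move=> e; rewrite ltcE => /andP[/eqP /= ie e0].
have [N hN] := h _ e0; exists N => // n /= /hN.
rewrite distrC normE ltcE /= => ->.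
by rewrite -ie eqxx.
Qed.

Lemma hcvg_cauchy u :
  (forall e : R, 0 < e -> exists N, forall m n, (N <= m)%N -> (N <= n)%N ->
    nr (u m - u n) < e) -> exists l, hcvg u l.
Proof.
move=> h; suff /cauchy_cvgP : cauchy (u n @[n --> \oo])%classic.
  by move=> /cvg_ex[l /hcvgP]; exists l.
apply/cauchyP => e; rewrite ltcE => /andP[/eqP /= ie e0].
have [N hN] := h _ e0; exists (u N); exists N => // n /= Nn.
rewrite -ball_normE /= normE ltcE /= -ie eqxx /=.
exact: hN.
Qed.

Lemma hcvg_rin u l x (e : R) : hcvg u l -> 0 < e ->
  exists N, forall n, (N <= n)%N -> `|rin (u n) x - rin l x| < e.
Proof.
move=> ul e0; have k0 : 0 < nr x + 1 by rewrite ltr_wpDl ?nr_ge0.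
have [|N hN] := ul (e / (nr x + 1)); first by rewrite divr_gt0.
exists N => n /hN; rewrite ltr_pdivlMr // => h.
rewrite -rinBl; apply: le_lt_trans (rin_abs_le _ _) _; apply: le_lt_trans h.
by rewrite ler_wpM2l ?nr_ge0 // lerDl.
Qed.

Lemma hcvg_rin_le u l x (c : R) : hcvg u l ->
  (exists N, forall n, (N <= n)%N -> rin (u n) x <= c) -> rin l x <= c.
Proof.
move=> ul [N hN]; apply/ler_addgt0Pr => e e0.
have [M hM] := hcvg_rin x ul e0.
have := hM _ (leq_maxr N M); have := hN _ (leq_maxl N M).
by rewrite ltr_norml => h1 /andP[h2 _]; lra.
Qed.

Lemma hcvg_unique u l l' : hcvg u l -> hcvg u l' -> l = l'.
Proof.
move=> h h'; apply/rin_inj => z; apply/eqP; rewrite eq_le; apply/andP; split;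
apply/ler_addgt0Pr => e e0;
have e20 : 0 < e / 2 by rewrite divr_gt0.
all: have [N hN] := hcvg_rin z h e20; have [M hM] := hcvg_rin z h' e20.
all: have := hN _ (leq_maxl N M); have := hM _ (leq_maxr N M).
all: rewrite !ltr_norml => /andP[? ?] /andP[? ?]; lra.
Qed.

Lemma hcvg_shift u l : hcvg u l -> hcvg (fun n => u n.+1) l.
Proof. by move=> h e /h[N hN]; exists N => n Nn; apply: hN; apply: leqW. Qed.

Lemma hcvgD u v l l' : hcvg u l -> hcvg v l' -> hcvg (fun n => u n + v n) (l + l').
Proof.
move=> h h' e e0; have e20 : 0 < e / 2 by rewrite divr_gt0.
have [N hN] := h _ e20; have [M hM] := h' _ e20.
exists (maxn N M) => n; rewrite geq_max => /andP[/hN h1 /hM h2].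
rewrite opprD addrACA; apply: le_lt_trans (nrD _ _) _; lra.
Qed.

Lemma hcvgZ (r : R) u l : hcvg u l -> hcvg (fun n => r%:C *: u n) (r%:C *: l).
Proof.
move=> h e e0; have k0 : 0 < `|r| + 1 by rewrite ltr_wpDl.
have [|N hN] := h (e / (`|r| + 1)); first by rewrite divr_gt0.
exists N => n /hN; rewrite ltr_pdivlMr // => hn.
rewrite -scalerBr nrZ; apply: le_lt_trans hn.
by rewrite mulrC ler_wpM2l ?nr_ge0 // lerDl.
Qed.

Lemma hcvg_cst x : hcvg (fun=> x) x.
Proof. by move=> e e0; exists 0%N => n _; rewrite subrr nr0. Qed.

End Convergence.

(** * Riesz representation and adjoints *)

Section Adjoint.
Variables (R : realType) (H : hilbertType R).
Implicit Types (x y z : H) (A B S T U : H -> H).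

(* The representing vector minimises [|x|^2 - 2 f x]. *)
Lemma riesz (f : H -> R) (M : R) :
  (forall x y, f (x + y) = f x + f y) -> (forall r x, f (r%:C *: x) = r * f x) ->
  (forall x, f x <= M * nr x) -> exists z, forall x, f x = rin x z.
Proof.
move=> fD fZ fM.
pose J x := nr x ^+ 2 - 2 * f x.
have JD x y (t : R) : J (x + t%:C *: y) =
    J x + 2 * t * (rin x y - f y) + t ^+ 2 * nr y ^+ 2.
  by rewrite /J fD fZ -!rinxx !(rinDl, rinDr, rinZl, rinZr) (rinC y x); ring.
have Jlb x : - M ^+ 2 <= J x.
  by have := fM x; have := sqr_ge0 (nr x - M); rewrite /J; lra.
have hi : has_inf (range J).
  by split; [exists (J 0), 0 | exists (- M ^+ 2) => _ [x _ <-]].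
pose m := inf (range J).
have mle x : m <= J x by apply: ge_inf; [exact: hi.2 | exists x].
have [u hu] : {u : nat -> H & forall n, J (u n) < m + n.+1%:R^-1}.
  apply: (@choice _ _ (fun n x => J x < m + n.+1%:R^-1)) => n.
  have [|_ [x _ <-] hx] := @inf_adherent _ (range J) n.+1%:R^-1 _ hi; last by exists x.
  by rewrite invr_gt0.
have arch (e : R) : 0 < e -> exists N, forall n, (N <= n)%N -> n.+1%:R^-1 < e.
  move=> e0; exists (Num.bound e^-1) => n hn.
  have h : e^-1 < n.+1%:R.
    apply: lt_le_trans (archi_boundP _) _; first by rewrite invr_ge0 ltW.
    by rewrite ler_nat ltnW.
  by rewrite -(invrK e) ltf_pV2 // posrE // invr_gt0.
(* A minimising sequence is Cauchy: by the parallelogram law |u_p - u_q|^2 equals 2 J(u_p) + 2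
   J(u_q) - 4 J(midpoint), hence is below 2/(p+1) + 2/(q+1). *)
have [z uz] : exists z, hcvg u z.
  apply: hcvg_cauchy => e e0.
  have [|N hN] := arch (e ^+ 2 / 4); first by rewrite divr_gt0 ?exprn_gt0.
  exists N => p q /hN hp /hN hq.
  rewrite -(@ltr_pXn2r _ 2) ?nnegrE ?nr_ge0 // ?(ltW e0) //.
  have h := mle (u p + (2^-1)%:C *: (u q - u p)).
  have : nr (u p - u q) ^+ 2 =
     2 * J (u p) + 2 * J (u q) - 4 * J (u p + (2^-1)%:C *: (u q - u p)).
    rewrite JD /J -!rinxx !(rinBl, rinBr, rinDl) (rinC (u q) (u p)).
    have -> : f (u q - u p) = f (u q) - f (u p).
      have -> : - u p = (-1)%:C *: u p by rewrite rmorphN1 scaleN1r.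
      by rewrite fD fZ; ring.
    by field.
  move: hp hq (hu p) (hu q).
  by set a := p.+1%:R^-1; set b := q.+1%:R^-1; lra.
exists z => x.
have key (t : R) : 0 <= 2 * t * (rin z x - f x) + t ^+ 2 * nr x ^+ 2.
  apply/ler_addgt0Pr => e e0.
  pose d := e / (2 * (1 + 2 * `|t|)).
  have d0 : 0 < d by rewrite divr_gt0 // mulr_gt0 // ltr_pwDl // mulr_ge0.
  have [N hN] := arch _ d0; have [M' hM'] := hcvg_rin x uz d0.
  have := hN _ (leq_maxl N M'); have := hM' _ (leq_maxr N M').
  set n := maxn _ _ => h1 h2.
  have := mle (u n + t%:C *: x); rewrite JD => h3; have h4 := hu n.
  have h5 : 2 * t * (rin (u n) x - rin z x) <= 2 * `|t| * d.
    apply: le_trans (ler_norm _) _; rewrite normrM.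
    have -> : `|2 * t| = 2 * `|t| by rewrite normrM ger0_norm.
    by apply: ler_wpM2l; [rewrite mulr_ge0 | rewrite ltW].
  have h6 : d * (1 + 2 * `|t|) = e / 2.
    have : 1 + 2 * `|t| != 0 by rewrite gt_eqF // ltr_pwDl // mulr_ge0.
    by rewrite /d => ?; field.
  by move: h2 h4; set a := n.+1%:R^-1; lra.
set d := rin z x - f x in key.
have k0 : 0 < 1 + nr x ^+ 2 by rewrite ltr_pwDl // sqr_ge0.
(* The quadratic in t is smallest at -d / |x|^2; the extra 1 in the denominator still makes it
   negative when d is nonzero, and covers x = 0. *)
have := key (- d / (1 + nr x ^+ 2)).
have -> : 2 * (- d / (1 + nr x ^+ 2)) * d + (- d / (1 + nr x ^+ 2)) ^+ 2 * nr x ^+ 2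
    = - (d ^+ 2 * ((2 + nr x ^+ 2) / (1 + nr x ^+ 2) ^+ 2)).
  by field; rewrite gt_eqF.
rewrite oppr_ge0 pmulr_lle0; last first.
  by rewrite divr_gt0 // ?exprn_gt0 // ltr_pwDl // sqr_ge0.
move=> dle; have /eqP : d ^+ 2 = 0 by apply/eqP; rewrite eq_le dle sqr_ge0.
by rewrite expf_eq0 /= /d subr_eq0 rinC => /eqP.
Qed.

End Adjoint.

(** * Bounded operators, adjoints and positivity *)

Section Operators.
Variables (R : realType) (H : hilbertType R).
Implicit Types (x y z : H) (A B S T U W Z : H -> H).

(** A relation rather than the chosen [adjoint], so that adjoints can be exhibited and composed
    directly; [adj_inner] upgrades it to the complex identity. *)
Definition adj S T := forall x y, rin (S x) y = rin x (T y).
Definition comm S T := forall x, S (T x) = T (S x).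

Lemma bopD T x y : bounded_op T -> T (x + y) = T x + T y.
Proof. by move=> [lT _]; rewrite -[x in LHS]scale1r lT scale1r. Qed.

Lemma bop0 T : bounded_op T -> T 0 = 0.
Proof.
by move=> bT; apply: (addIr (T 0)); rewrite -bopD // !add0r.
Qed.

Lemma bopZ T c x : bounded_op T -> T (c *: x) = c *: T x.
Proof. by move=> bT; rewrite -[c *: x]addr0 bT.1 (bop0 bT) addr0. Qed.

Lemma bopN T x : bounded_op T -> T (- x) = - T x.
Proof. by move=> bT; rewrite -scaleN1r bopZ // scaleN1r. Qed.

Lemma bopB T x y : bounded_op T -> T (x - y) = T x - T y.
Proof. by move=> bT; rewrite bopD // bopN. Qed.

Lemma bop_bound T : bounded_op T ->
  exists M, 0 <= M /\ forall x, nr (T x) <= M * nr x.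
Proof.
move=> [_ [M hM]]; exists `|M|; split=> // x.
have := hM x; rewrite !normE -rmorphM lecR => /le_trans; apply.
by rewrite ler_wpM2r ?nr_ge0 // ler_norm.
Qed.

Lemma bopI T M : linear T -> (forall x, nr (T x) <= M * nr x) -> bounded_op T.
Proof. by move=> lT h; split => //; exists M => x; rewrite !normE -rmorphM lecR. Qed.

Lemma opDE S T x : (S + T) x = S x + T x. Proof. by []. Qed.
Lemma opNE T x : (- T) x = - T x. Proof. by []. Qed.
Lemma opBE S T x : (S - T) x = S x - T x. Proof. by []. Qed.
Lemma opZE (c : R[i]) T x : (c *: T) x = c *: T x. Proof. by []. Qed.
Lemma op0E x : (0 : H -> H) x = 0. Proof. by []. Qed.
Definition opE := (opBE, opDE, opNE, opZE, op0E).

Lemma bop_id : bounded_op (id : H -> H).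
Proof. by apply: (@bopI _ 1) => // x; rewrite mul1r. Qed.

Lemma bop_comp S T : bounded_op S -> bounded_op T -> bounded_op (S \o T).
Proof.
move=> bS bT; have [M [M0 hM]] := bop_bound bS; have [N [N0 hN]] := bop_bound bT.
apply: (@bopI _ (M * N)) => [a x y /=|x]; first by rewrite bT.1 bS.1.
by apply: le_trans (hM _) _; rewrite -mulrA ler_wpM2l.
Qed.

Lemma bop_iter T n : bounded_op T -> bounded_op (iter n T).
Proof.
by move=> bT; elim: n => [|n ih]; [exact: bop_id | exact: (bop_comp bT ih)].
Qed.

Lemma bop_add S T : bounded_op S -> bounded_op T -> bounded_op (S + T).
Proof.
move=> bS bT; have [M [M0 hM]] := bop_bound bS; have [N [N0 hN]] := bop_bound bT.
apply: (@bopI _ (M + N)) => [a x y|x].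
  by rewrite !opDE bT.1 bS.1 addrACA scalerDr.
by apply: le_trans (nrD _ _) _; rewrite mulrDl lerD.
Qed.

Lemma bop_scale r T : bounded_op T -> bounded_op (r%:C *: T).
Proof.
move=> bT; have [M [M0 hM]] := bop_bound bT.
apply: (@bopI _ (`|r| * M)) => [a x y|x].
  by rewrite !opZE bT.1 scalerDr !scalerA mulrC.
by rewrite nrZ -mulrA ler_wpM2l.
Qed.

Lemma bop_opp T : bounded_op T -> bounded_op (- T).
Proof.
by move=> /(bop_scale (-1)); rewrite rmorphN1 scaleN1r.
Qed.

Lemma bop_sub S T : bounded_op S -> bounded_op T -> bounded_op (S - T).
Proof. by move=> bS /bop_opp; exact: bop_add. Qed.

Lemma hcvg_op T (u : nat -> H) l : bounded_op T -> hcvg u l ->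
  hcvg (fun n => T (u n)) (T l).
Proof.
move=> bT h e e0; have [M [M0 hM]] := bop_bound bT.
have k0 : 0 < M + 1 by rewrite ltr_wpDl.
have [|N hN] := h (e / (M + 1)); first by rewrite divr_gt0.
exists N => n /hN; rewrite ltr_pdivlMr // => hn.
rewrite -bopB //; apply: le_lt_trans (hM _) _; apply: le_lt_trans hn.
by rewrite mulrC ler_wpM2l ?nr_ge0 // lerDl.
Qed.

Lemma adj_inner S T : bounded_op S -> adj S T ->
  forall x y, inner (S x) y = inner x (T y).
Proof.
move=> bS h x y; rewrite !innerE h; congr (_ +i* _).
have e (a b : H) : rin a ('i *: b) = - rin ('i *: a) b by rewrite rin_i opprK.
by rewrite !e -(bopZ _ _ bS) h.
Qed.

Lemma inner_adj S T : (forall x y, inner (S x) y = inner x (T y)) -> adj S T.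
Proof. by move=> h x y; rewrite /rin h. Qed.

Lemma adj_sym S T : adj S T -> adj T S.
Proof. by move=> h x y; rewrite rinC -h rinC. Qed.

Lemma adj_comp A B S T : adj A B -> adj S T -> adj (A \o S) (T \o B).
Proof. by move=> h h' x y /=; rewrite h h'. Qed.

Lemma adj_iter n S T : adj S T -> adj (iter n S) (iter n T).
Proof.
by move=> h; elim: n => [|n ih] x y //; rewrite iterS h ih -iterSr.
Qed.

Lemma adj_add A B S T : adj A B -> adj S T -> adj (A + S) (B + T).
Proof. by move=> h h' x y; rewrite !opE rinDl rinDr h h'. Qed.

Lemma adj_scale r S T : adj S T -> adj (r%:C *: S) (r%:C *: T).
Proof. by move=> h x y; rewrite !opE rinZl rinZr h. Qed.

Lemma adj_sub A B S T : adj A B -> adj S T -> adj (A - S) (B - T).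
Proof. by move=> h h' x y; rewrite !opE rinBl rinBr h h'. Qed.

(** Linearity follows by testing against all vectors, and the bound from |T y|^2 = <S (T y), y> <= M
    |T y| |y|. *)
Lemma adj_bop S T : bounded_op S -> adj S T -> bounded_op T.
Proof.
move=> bS h; have [M [M0 hM]] := bop_bound bS.
have hi := adj_inner bS h.
apply: (@bopI _ M) => [a x y|y].
  apply: rin_inj => z; rewrite ![rin _ z]rinC /rin; congr complex.Re.
  by rewrite -hi !innerDr !innerZr !hi.
have [->|y0] := eqVneq (nr (T y)) 0; first by rewrite mulr_ge0 ?nr_ge0.
have p : 0 < nr (T y) by rewrite lt_neqAle eq_sym y0 nr_ge0.
rewrite -(ler_pM2l p) -expr2 -rinxx -h; apply: le_trans (rin_le _ _) _.
by rewrite mulrA [_ * M]mulrC ler_wpM2r ?nr_ge0.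
Qed.

Lemma adj_uniq S T W : adj S T -> adj S W -> T = W.
Proof.
move=> h h'; apply/funext => y; apply: rin_inj => z.
by rewrite ![rin _ z]rinC -h h'.
Qed.

Lemma exists_adj T : bounded_op T -> exists S, adj T S.
Proof.
move=> bT; have [M [M0 hM]] := bop_bound bT.
suff : forall y, exists z, forall x, rin (T x) y = rin x z.
  by move=> /choice[S hS]; exists S.
move=> y; apply: (@riesz _ _ (fun x => rin (T x) y) (M * nr y)).
- by move=> x z; rewrite bopD // rinDl.
- by move=> r x; rewrite bopZ // rinZl.
- move=> x; apply: le_trans (rin_le _ _) _.
  by rewrite mulrAC ler_wpM2r ?nr_ge0.
Qed.

Lemma adjoint_eq S T : bounded_op S -> adj S T -> adjoint S = T.
Proof.
move=> bS h; rewrite /adjoint; case: xgetP => [W _ [_ /inner_adj hW]|/(_ T)[]].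
  exact: adj_uniq hW h.
by split; [exact: adj_bop h | exact: adj_inner].
Qed.

Lemma adjointP T : bounded_op T -> adj T (adjoint T).
Proof. by move=> bT; have [S hS] := exists_adj bT; rewrite (adjoint_eq bT hS). Qed.

Lemma bop_adjoint T : bounded_op T -> bounded_op (adjoint T).
Proof. by move=> bT; exact: adj_bop (adjointP bT). Qed.

Definition psd S := [/\ bounded_op S, adj S S & forall x, 0 <= rin (S x) x].

(** A complex operator with real quadratic form is symmetric: the defect q(x, y) = <S x, y> - <x, S
    y> vanishes on the diagonal, so it is antisymmetric, while q(i x, y) = i q(x, y) and q(x, i y) =
    -i q(x, y). Together these force q = 0. *)
Lemma positive_opP S : positive_op S <-> psd S.
Proof.
split=> [[bS h]|[bS sS h]]; last first.
  split=> // x; rewrite innerE lecE /=; apply/andP; split; last exact: h.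
  have e : rin (S x) ('i *: x) = rin x ('i *: S x) by rewrite -(bopZ _ _ bS) sS.
  by have := rin_i x (S x); rewrite rinC -e => ?; apply/eqP; lra.
split=> // [x y|x]; last by have := h x; rewrite lecE => /andP[].
pose q x y := inner (S x) y - inner x (S y).
have qD a b c : q (a + b) c = q a c + q b c.
  by rewrite /q bopD // !innerDl; ring.
have qDr a b c : q c (a + b) = q c a + q c b.
  by rewrite /q bopD // !innerDr; ring.
have q0 a : q a a = 0.
  rewrite /q [inner a (S a)](hermC inner) expr0 mul1r /=.
  have := h a; rewrite lecE => /andP[/eqP /=].
  by case: (inner (S a) a) => c d /= -> _; apply/eqP; rewrite eq_complex /= oppr0 !subrr eqxx.
have anti a b : q a b = - q b a.
  have := q0 (a + b); rewrite qD !qDr !q0 add0r addr0 => /eqP.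
  by rewrite addr_eq0 => /eqP.
have qi a b : q ('i *: a) b = 'i * q a b.
  by rewrite /q bopZ // !innerZl /= mulrBr.
have qir a b : q a ('i *: b) = - ('i * q a b).
  rewrite /q bopZ // !innerZr /=.
  case: (inner (S a) b) (inner a (S b)) => [? ?] [? ?]; apply/eqP.
  by rewrite eq_complex /=; apply/andP; split; apply/eqP; ring.
have : q ('i *: x) y = - (q ('i *: x) y).
  by rewrite {1}anti qir opprK qi anti mulrN -qi.
move=> /eqP; rewrite -addr_eq0 -mulr2n mulrn_eq0 /= qi mulf_eq0 eq_complex /= oner_eq0 andbF /=.
by rewrite subr_eq0 /rin => /eqP ->.
Qed.

End Operators.

(** * Positive operators *)

Section Positive.
Variables (R : realType) (H : hilbertType R).
Implicit Types (x y z : H) (A B S T U W X Y Z : H -> H).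

Lemma nrD_sq x y : nr (x + y) ^+ 2 = nr x ^+ 2 + 2 * rin x y + nr y ^+ 2.
Proof. by rewrite -!rinxx rinDl !rinDr (rinC y x); ring. Qed.

Lemma nrB_sq x y : nr (x - y) ^+ 2 = nr x ^+ 2 - 2 * rin x y + nr y ^+ 2.
Proof. by rewrite nrD_sq rinNr nrN; ring. Qed.

Lemma hcvg_rin_ge (u : nat -> H) l x (c : R) : hcvg u l ->
  (exists N, forall n, (N <= n)%N -> c <= rin (u n) x) -> c <= rin l x.
Proof.
move=> ul [N hN]; rewrite -lerN2 -rinNr; apply: (hcvg_rin_le ul).
by exists N => n /hN; rewrite rinNr lerN2.
Qed.

Lemma hcvg_rin_eq (u v : nat -> H) l l' x y : hcvg u l -> hcvg v l' ->
  (forall n, rin (u n) x = rin (v n) y) -> rin l x = rin l' y.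
Proof.
move=> h h' uv; apply/eqP; rewrite eq_le; apply/andP; split;
apply/ler_addgt0Pr => e e0;
have e20 : 0 < e / 2 by rewrite divr_gt0.
all: have [N hN] := hcvg_rin x h e20; have [M hM] := hcvg_rin y h' e20.
all: have := hN _ (leq_maxl N M); have := hM _ (leq_maxr N M).
all: rewrite uv !ltr_norml => /andP[? ?] /andP[? ?]; lra.
Qed.

Lemma quad_discr (a b c : R) : 0 <= c ->
  (forall t, 0 <= a + 2 * t * b + t ^+ 2 * c) -> b ^+ 2 <= a * c.
Proof.
move=> c0 h; have [cz|cn] := eqVneq c 0.
  have [->|bn] := eqVneq b 0; first by rewrite cz expr0n mulr0.
  (* For c = 0 the polynomial is affine in t, and this t gives it the value -1. *)
  have := h (- (a + 1) / (2 * b)); rewrite cz mulr0 addr0.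
  have -> : a + 2 * (- (a + 1) / (2 * b)) * b = -1 by field.
  by rewrite oppr_ge0 ler10.
have cp : 0 < c by rewrite lt_neqAle eq_sym cn.
have := h (- b / c).
have -> : a + 2 * (- b / c) * b + (- b / c) ^+ 2 * c = (a * c - b ^+ 2) / c by field.
by rewrite pmulr_lge0 ?invr_gt0 // subr_ge0.
Qed.

Lemma psd_CS S x y : psd S ->
  rin (S x) y ^+ 2 <= rin (S x) x * rin (S y) y.
Proof.
move=> [bS sS pS]; apply: quad_discr => // t.
have := pS (x + t%:C *: y).
rewrite bopD // bopZ // !(rinDl, rinDr, rinZl, rinZr).
rewrite (sS y x) (rinC y (S x)) => h.
by apply: le_trans h _; rewrite le_eqVlt; apply/orP; left; apply/eqP; ring.
Qed.

Definition fle S T := forall x, rin (S x) x <= rin (T x) x.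
Definition fbound (c : R) S := forall x, rin (S x) x <= c * nr x ^+ 2.

Lemma psd_fbound S : psd S -> exists c, 0 < c /\ fbound c S.
Proof.
move=> [bS _ _]; have [M [M0 hM]] := bop_bound bS.
exists (M + 1); split; first by rewrite ltr_wpDl.
move=> x; apply: le_trans (rin_le _ _) _; rewrite expr2 mulrA.
rewrite ler_wpM2r ?nr_ge0 //; apply: le_trans (hM _) _.
by rewrite ler_wpM2r ?nr_ge0 // lerDl.
Qed.

(** Cauchy-Schwarz for the form of S, applied to x and S x, gives |S x|^4 <= <S x, x> <S (S x), S x>
    <= c <S x, x> |S x|^2. *)
Lemma psd_sqnr S c x : psd S -> 0 <= c -> fbound c S ->
  nr (S x) ^+ 2 <= c * rin (S x) x.
Proof.
move=> pS c0 h; have := psd_CS x (S x) pS; rewrite rinxx => h1.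
have h2 := h (S x); have [_ _ /(_ x) h3] := pS.
have [->|n0] := eqVneq (nr (S x)) 0; first by rewrite expr0n mulr_ge0.
have p : 0 < nr (S x) ^+ 2 by rewrite exprn_gt0 // lt_neqAle eq_sym n0 nr_ge0.
rewrite -(ler_pM2r p) -expr2; apply: le_trans h1 _.
by rewrite mulrAC mulrC ler_wpM2r.
Qed.

Lemma psd_nr S c x : psd S -> 0 <= c -> fbound c S -> nr (S x) <= c * nr x.
Proof.
move=> pS c0 h; have h1 := psd_sqnr x pS c0 h.
have [->|n0] := eqVneq (nr (S x)) 0; first by rewrite mulr_ge0 ?nr_ge0.
have p : 0 < nr (S x) by rewrite lt_neqAle eq_sym n0 nr_ge0.
rewrite -(ler_pM2l p) -expr2; apply: le_trans h1 _.
rewrite [X in _ <= X]mulrCA ler_wpM2l //; exact: rin_le.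
Qed.

Lemma psd_ker S x : psd S -> rin (S x) x = 0 -> S x = 0.
Proof.
move=> pS h; have [c [c0 hc]] := psd_fbound pS.
have := psd_sqnr x pS (ltW c0) hc; rewrite h mulr0 => h1.
apply: nr_eq0; apply/eqP; rewrite -[_ == 0](expf_eq0 _ 2) eq_le h1.
exact: sqr_ge0.
Qed.

Lemma psd_add S T : psd S -> psd T -> psd (S + T).
Proof.
move=> [bS sS pS] [bT sT pT]; split; [exact: bop_add | exact: adj_add |].
by move=> x; rewrite opE rinDl addr_ge0.
Qed.

Lemma psd_scale r S : 0 <= r -> psd S -> psd (r%:C *: S).
Proof.
move=> r0 [bS sS pS]; split; [exact: bop_scale | exact: adj_scale |].
by move=> x; rewrite opE rinZl mulr_ge0.
Qed.

Lemma psd_id : psd (id : H -> H).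
Proof. by split=> //; [exact: bop_id | move=> x; exact: rinxx_ge0]. Qed.

Lemma psd_0 : psd (0 : H -> H).
Proof.
split=> [|x y|x]; rewrite ?op0E ?rin0l ?rin0r //.
by apply: (@bopI _ _ _ 0) => [a x y|x]; rewrite !op0E ?scaler0 ?addr0 ?nr0 ?mul0r.
Qed.

Lemma psd_sub S T : psd S -> psd T -> fle S T -> psd (T - S).
Proof.
move=> [bS sS _] [bT sT _] h; split; [exact: bop_sub | exact: adj_sub |].
by move=> x; rewrite opE rinBl subr_ge0.
Qed.

Lemma psd_sq S : bounded_op S -> adj S S -> psd (S \o S).
Proof.
move=> bS sS; split; [exact: bop_comp | exact: adj_comp |].
by move=> x /=; rewrite sS rinxx_ge0.
Qed.

Lemma psd_conj S U U' : psd S -> bounded_op U -> adj U U' -> psd (U' \o S \o U).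
Proof.
move=> [bS sS pS] bU aU; split.
- by apply: bop_comp => //; apply: bop_comp => //; exact: adj_bop aU.
- have := adj_comp (adj_comp (adj_sym aU) sS) aU.
  by move=> h x y; rewrite h.
- by move=> x /=; rewrite (adj_sym aU).
Qed.

(** Products of strongly convergent sequences converge once the left factors are uniformly bounded:
    split X_n u_n as X_n (u_n - l) + X_n l. *)
Lemma hcvg_comp (X : nat -> H -> H) Y (u : nat -> H) l M :
  (forall n, bounded_op (X n)) -> (forall n x, nr (X n x) <= M * nr x) ->
  (forall x, hcvg (fun n => X n x) (Y x)) -> hcvg u l ->
  hcvg (fun n => X n (u n)) (Y l).
Proof.
move=> bX hM hX ul.
have -> : (fun n => X n (u n)) = (fun n => X n (u n - l) + X n l).
  by apply/funext => n; rewrite bopB // subrK.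
rewrite -[Y l]add0r; apply: hcvgD (hX l).
move=> e e0; have k0 : 0 < `|M| + 1 by rewrite ltr_wpDl.
have [|N hN] := ul (e / (`|M| + 1)); first by rewrite divr_gt0.
exists N => n /hN; rewrite ltr_pdivlMr // => hn; rewrite subr0.
apply: le_lt_trans (hM _ _) _; apply: le_lt_trans hn.
rewrite mulrC ler_wpM2l ?nr_ge0 //; apply: le_trans (ler_norm _) _.
by rewrite lerDl.
Qed.

(** The real numbers <X_n x, x> increase and are bounded, and [psd_sqnr] applied to X_n - X_N bounds
    |X_n x - X_N x|^2 by c times their increment. So X_n x is Cauchy. *)
Lemma monotone_sot (X : nat -> H -> H) c : 0 <= c ->
  (forall n, psd (X n)) -> (forall n, fle (X n) (X n.+1)) ->
  (forall n, fbound c (X n)) ->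
  exists Y, [/\ psd Y, forall x, hcvg (fun n => X n x) (Y x),
    forall n, fle (X n) Y & fbound c Y].
Proof.
move=> c0 pX mX bX.
have mono m n : (m <= n)%N -> fle (X m) (X n).
  move=> /subnK <-; elim: (n - m)%N => [|k ih] x //.
  by apply: le_trans (ih x) _; exact: mX.
have : forall x, exists l, hcvg (fun n => X n x) l.
  move=> x; apply: hcvg_cauchy => e e0.
  pose a n := rin (X n x) x.
  have hs : has_sup (range a).
    by split; [exists (a 0%N), 0%N | exists (c * nr x ^+ 2) => _ [n _ <-]; exact: bX].
  (* Dividing by c + 1 instead of c allows c = 0. *)
  pose d := (e / 2) ^+ 2 / (c + 1).
  have c1 : 0 < c + 1 by rewrite ltr_wpDl.
  have d0 : 0 < d by rewrite divr_gt0 // exprn_gt0 // divr_gt0.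
  have [_ [N _ <-] hN] := @sup_adherent _ (range a) d d0 hs.
  have key n : (N <= n)%N -> nr (X n x - X N x) < e / 2.
    move=> Nn; have pD := psd_sub (pX N) (pX n) (mono _ _ Nn).
    have bD : fbound c (X n - X N).
      move=> y; rewrite opE rinBl; apply: le_trans (bX n y).
      by rewrite gerBl; have [] := pX N.
    have := psd_sqnr x pD c0 bD; rewrite opE rinBl => h.
    have h2 : a n <= sup (range a) by apply: ub_le_sup; [exact: hs.2 | exists n].
    have h3 : a n - a N < d by move: hN h2; lra.
    rewrite -(@ltr_pXn2r _ 2) ?nnegrE ?nr_ge0 ?divr_ge0 ?(ltW e0) //.
    apply: le_lt_trans h _; have h4 : d * (c + 1) = (e / 2) ^+ 2.
      by rewrite /d divfK // gt_eqF.
    have h5 : a N <= a n by exact: mono.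
    by rewrite -h4; rewrite -/(a n) -/(a N); nra.
  exists N => m n Nm Nn.
  have -> : X m x - X n x = (X m x - X N x) - (X n x - X N x).
    by rewrite opprB addrA subrK.
  apply: le_lt_trans (nrD _ _) _; rewrite nrN.
  by have := key _ Nm; have := key _ Nn; lra.
move=> /choice[Y hY].
have lY : linear Y.
  move=> k x y; apply: (hcvg_unique (hY _)).
  have -> : (fun n => X n (k *: x + y)) = (fun n => X n (k *: x) + X n y).
    by apply/funext => n; rewrite bopD //; have [] := pX n.
  apply: hcvgD => //.
  have -> : (fun n => X n (k *: x)) = (fun n => ( *:%R k) (X n x)).
    by apply/funext => n; rewrite bopZ //; have [] := pX n.
  apply: (@hcvg_op _ _ ( *:%R k)) => //; split.
    by move=> r u v; rewrite scalerDr !scalerA mulrC.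
  by exists (complex.Re `|k|) => u; rewrite normrZ (RRe_real (ger0_real (normr_ge0 k))).
have nY x : nr (Y x) <= c * nr x.
  have [->|n0] := eqVneq (nr (Y x)) 0; first by rewrite mulr_ge0 ?nr_ge0.
  have p : 0 < nr (Y x) by rewrite lt_neqAle eq_sym n0 nr_ge0.
  rewrite -(ler_pM2r p) -expr2 -rinxx; apply: (hcvg_rin_le (hY x)).
  exists 0%N => n _; apply: le_trans (rin_le _ _) _.
  by rewrite ler_wpM2r ?nr_ge0 // psd_nr.
have mY n : fle (X n) Y.
  move=> x; apply: (hcvg_rin_ge (hY x)); exists n => m nm; exact: mono.
have bY : bounded_op Y by exact: bopI nY.
exists Y; split => //.
  split=> // [x y|x].
    rewrite [RHS]rinC; apply: (hcvg_rin_eq (hY x) (hY y)) => n.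
    by have [_ sX _] := pX n; rewrite sX rinC.
  by apply: le_trans (mY 0%N x); have [] := pX 0%N.
by move=> x; apply: (hcvg_rin_le (hY x)); exists 0%N => n _; exact: bX.
Qed.

(* Q W' = 0 since W Q = 0, hence W W' = 0 by the kernel condition, and W' = 0. *)
Lemma cancel_op W W' Q : bounded_op W -> adj W W' -> adj Q Q ->
  (forall x, W (Q x) = 0) -> (forall x, Q x = 0 -> W x = 0) -> forall x, W x = 0.
Proof.
move=> bW aW aQ WQ kQ x.
have W'0 y : W' y = 0.
  apply: rinxx_eq0; rewrite -aW kQ ?rin0l //.
  by apply: rin_eq0 => z; rewrite aQ (adj_sym aW) WQ rin0r.
by apply: rin_eq0 => y; rewrite aW W'0 rin0r.
Qed.

(* Let l > 0 be the supremum of the form of Y - X on the unit sphere.  On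
   approximate maximisers Y x is close to X x + l x, and the square of the norm
   of the latter is at least [|X x|^2 + l^2]. *)
Lemma loewner_heinz X Y : psd X -> psd Y -> (forall x, nr (Y x) <= nr (X x)) ->
  fle Y X.
Proof.
move=> pX pY h x0; rewrite leNgt; apply/negP => hx0.
have [bX sX pX'] := pX; have [bY sY _] := pY.
have [MX [MX0 hMX]] := bop_bound bX; have [MY [MY0 hMY]] := bop_bound bY.
pose D := Y - X.
have bD : bounded_op D by exact: bop_sub.
have DE x : rin (D x) x = rin (Y x) x - rin (X x) x by rewrite /D opE rinBl.
have DZ r x : rin (D (r%:C *: x)) (r%:C *: x) = r ^+ 2 * rin (D x) x.
  by rewrite bopZ // rinZl rinZr mulrA expr2.
pose E := [set rin (D x) x | x in [set x : H | nr x = 1]]%classic.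
have norm1 x : nr x != 0 -> nr ((nr x)^-1%:C *: x) = 1.
  by move=> n0; rewrite nrZ ger0_norm ?invr_ge0 ?nr_ge0 // mulVf.
have x0n : nr x0 != 0.
  by apply/eqP => /nr_eq0 e; move: hx0; rewrite e !rin0r ltxx.
have hE : has_sup E.
  split; first by eexists; exists ((nr x0)^-1%:C *: x0); [exact: norm1 | reflexivity].
  exists MY => _ [x /= nx <-]; rewrite DE.
  have := rin_le (Y x) x; have := hMY x; have := pX' x; rewrite nx; lra.
pose l := sup E.
have lE x : nr x = 1 -> rin (D x) x <= l.
  by move=> nx; apply: ub_le_sup; [exact: hE.2 | exists x].
have lD x : rin (D x) x <= l * nr x ^+ 2.
  have [n0|n0] := eqVneq (nr x) 0.
    by rewrite (nr_eq0 n0) rin0r nr0 expr0n mulr0.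
  have := lE _ (norm1 _ n0); rewrite DZ exprVn ler_pdivrMl 1?mulrC //.
  by rewrite exprn_gt0 // lt_neqAle eq_sym n0 nr_ge0.
have l0 : 0 < l.
  have : 0 < rin (D x0) x0 by rewrite DE subr_gt0.
  have := lD x0 => h1 h2; have := lt_le_trans h2 h1.
  by rewrite pmulr_lgt0 // exprn_gt0 // lt_neqAle eq_sym x0n nr_ge0.
pose K := l%:C *: id - D.
have KE x : K x = l%:C *: x - D x by [].
have pK : psd K.
  split; [apply: bop_sub => //; apply: bop_scale; exact: bop_id | |].
    apply: adj_sub; [exact: adj_scale | exact: adj_sub].
  by move=> x; rewrite KE rinBl rinZl rinxx subr_ge0.
have [c [c0 hc]] := psd_fbound pK.
pose M := MX + l.
have M0 : 0 < M by rewrite ltr_wpDl.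
(* From |p - K x| <= |X x| and |p|^2 >= |X x|^2 + l^2 one gets l^2 <= 2 M |K x|; with |K x|^2 <= c
   <K x, x> this yields <K x, x> >= d. A maximiser up to d has <K x, x> < d, a contradiction. *)
pose d := l ^+ 4 / (4 * M ^+ 2 * c).
have q0 : 0 < 4 * M ^+ 2 * c by rewrite !mulr_gt0 // exprn_gt0.
have d0 : 0 < d by rewrite divr_gt0 // exprn_gt0.
have [_ [x /= nx <-] hx] := @sup_adherent _ E d d0 hE.
pose p := X x + l%:C *: x.
have Yx : Y x = p - K x.
  by apply: rin_inj => z; rewrite KE /p /D opE !(rinBl, rinDl, rinNl, rinZl); ring.
have hp : nr p <= M.
  apply: le_trans (nrD _ _) _; rewrite nrZ nx mulr1 gtr0_norm // lerD2r.
  by have := hMX x; rewrite nx mulr1.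
have h1 : nr (Y x) ^+ 2 = nr p ^+ 2 - 2 * rin p (K x) + nr (K x) ^+ 2.
  by rewrite Yx; exact: nrB_sq.
have h2 : nr p ^+ 2 = nr (X x) ^+ 2 + 2 * l * rin (X x) x + l ^+ 2.
  by rewrite /p nrD_sq nrZ nx mulr1 rinZr gtr0_norm // mulrA.
have h3 : nr (Y x) ^+ 2 <= nr (X x) ^+ 2 by rewrite ler_sqr ?nnegrE ?nr_ge0.
have h4 := rin_le p (K x).
have h5 : nr p * nr (K x) <= M * nr (K x) by rewrite ler_wpM2r ?nr_ge0.
have h6 : l ^+ 2 <= 2 * M * nr (K x).
  have : 0 <= l * rin (X x) x by rewrite mulr_ge0 // ltW.
  by have := sqr_ge0 (nr (K x)); lra.
have h7 : l ^+ 4 <= 4 * M ^+ 2 * nr (K x) ^+ 2.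
  have -> : 4 * M ^+ 2 * nr (K x) ^+ 2 = (2 * M * nr (K x)) ^+ 2 by ring.
  have -> : l ^+ 4 = (l ^+ 2) ^+ 2 by ring.
  by rewrite ler_sqr ?nnegrE ?sqr_ge0 // !mulr_ge0 ?nr_ge0 // ltW.
have h8 := psd_sqnr x pK (ltW c0) hc.
have h9 : d <= rin (K x) x.
  rewrite ler_pdivrMr //; apply: le_trans h7 _.
  have -> : rin (K x) x * (4 * M ^+ 2 * c) = 4 * M ^+ 2 * (c * rin (K x) x) by ring.
  by rewrite ler_wpM2l // mulr_ge0 // sqr_ge0.
move: h9 hx; rewrite KE rinBl rinZl rinxx nx expr1n mulr1 -/l; lra.
Qed.

End Positive.

(** * Square roots *)

Section SquareRoot.
Variables (R : realType) (H : hilbertType R).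
Implicit Types (x y z : H) (A B S T X Y Z : H -> H).

(** With j the half of k, the form of B^k at x is |B^j x|^2 for even k, and the form of B at B^j x
    for odd k. *)
Lemma psd_iter B k : psd B -> psd (iter k B).
Proof.
move=> pB; have [bB sB _] := pB.
have sym n : adj (iter n B) (iter n B) by exact: adj_iter.
split; [exact: bop_iter | exact: sym |] => x.
rewrite -(odd_double_half k) addnC -addnn -addnA iterD sym.
case: (odd k) => /=; last by rewrite addn0 rinxx_ge0.
by rewrite addn1 iterS; have [_ _] := pB.
Qed.

(* Such polynomials in a positive B are visibly positive, which spares the
   theorem that a product of commuting positive operators is positive. *)
Inductive nnpoly B : (H -> H) -> Prop :=
| nnpoly0 : nnpoly B 0
| nnpolyC c k X : 0 <= c -> nnpoly B X -> nnpoly B (c%:C *: iter k B + X).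

Lemma nnpoly_psd B X : psd B -> nnpoly B X -> psd X.
Proof.
move=> pB; elim=> [|c k Y c0 _ ih]; first exact: psd_0.
by apply: psd_add => //; apply: psd_scale => //; exact: psd_iter.
Qed.

Lemma nnpolyD B X Y : nnpoly B X -> nnpoly B Y -> nnpoly B (X + Y).
Proof.
move=> nX nY; elim: nX => [|c k Z c0 _ ih]; first by rewrite add0r.
by rewrite -addrA; exact: nnpolyC.
Qed.

Lemma nnpolyZ B X r : 0 <= r -> nnpoly B X -> nnpoly B (r%:C *: X).
Proof.
move=> r0; elim=> [|c k Z c0 _ ih]; first by rewrite scaler0; exact: nnpoly0.
by rewrite scalerDr scalerA -rmorphM; apply: nnpolyC => //; rewrite mulr_ge0.
Qed.

Lemma nnpolyM B X Y : bounded_op B -> nnpoly B X -> nnpoly B Y -> nnpoly B (X \o Y).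
Proof.
move=> bB nX nY; elim: nX => [|c k Z c0 _ ih]; first exact: nnpoly0.
have -> : (c%:C *: iter k B + Z) \o Y = c%:C *: (iter k B \o Y) + (Z \o Y) by [].
apply: nnpolyD => //; apply: nnpolyZ => //.
elim: nY => [|d j V d0 _ ihV].
  have -> : iter k B \o (0 : H -> H) = 0; last exact: nnpoly0.
  by apply/funext => x /=; rewrite !op0E (bop0 (bop_iter k bB)).
have -> : iter k B \o (d%:C *: iter j B + V) = d%:C *: iter (k + j) B + (iter k B \o V).
  apply/funext => x /=; rewrite !opE (bopD _ _ (bop_iter k bB)).
  by rewrite (bopZ _ _ (bop_iter k bB)) iterD.
exact: nnpolyC.
Qed.

Lemma nnpoly_id B : nnpoly B B.
Proof.
have {2}-> : B = 1%:C *: iter 1 B + 0 by rewrite rmorph1 scale1r addr0.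
by apply: nnpolyC => //; exact: nnpoly0.
Qed.

Lemma comm_iter Z B k : comm Z B -> comm Z (iter k B).
Proof. by move=> h x; elim: k => [//|k ih]; rewrite !iterS h ih. Qed.

Lemma nnpoly_comm Z B X : bounded_op Z -> comm Z B -> nnpoly B X -> comm Z X.
Proof.
move=> bZ cZ; elim=> [|c k Y c0 _ ih] x; first by rewrite !op0E bop0.
by rewrite !opE bopD // bopZ // (comm_iter k cZ) ih.
Qed.

(* The Riesz-Nagy iteration for the solution of [y = (b + y^2) / 2]; if
   [b = 1 - a] then [1 - y] is a square root of [a]. *)
Fixpoint sqrt_iter B n : H -> H :=
  if n is n'.+1 then (2^-1)%:C *: (B + (sqrt_iter B n' \o sqrt_iter B n')) else 0.

Lemma sqrt_iterS B n :
  sqrt_iter B n.+1 = (2^-1)%:C *: (B + (sqrt_iter B n \o sqrt_iter B n)).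
Proof. by []. Qed.

Lemma sqrt_iter_nnpoly B n : bounded_op B -> nnpoly B (sqrt_iter B n).
Proof.
move=> bB; elim: n => [|n ih]; first exact: nnpoly0.
by apply: nnpolyZ => //; apply: nnpolyD; [exact: nnpoly_id | exact: nnpolyM].
Qed.

(** For consecutive iterates Y and V = Y + D one has V^2 - Y^2 = Y D + D V, so the next increment is
    again a polynomial in B with nonnegative coefficients. This makes the iteration increasing. *)
Lemma sqrt_iter_step B n : psd B ->
  exists D, nnpoly B D /\ sqrt_iter B n.+1 = sqrt_iter B n + D.
Proof.
move=> pB; have [bB _ _] := pB; elim: n => [|n [D [nD e]]].
  exists ((2^-1)%:C *: B); split; first by apply: nnpolyZ => //; exact: nnpoly_id.
  by rewrite add0r; congr (_ *: _); apply/funext => x; rewrite !opE /= op0E addr0.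
have nY := sqrt_iter_nnpoly n bB; have nY1 := sqrt_iter_nnpoly n.+1 bB.
exists ((2^-1)%:C *: ((sqrt_iter B n \o D) + (D \o sqrt_iter B n.+1))); split.
  by apply: nnpolyZ => //; apply: nnpolyD; exact: nnpolyM.
apply: etrans (sqrt_iterS _ _) _.
set Y := sqrt_iter B n in e nY *; set V := sqrt_iter B n.+1 in e nY1 *.
have eV : V = (2^-1)%:C *: (B + (Y \o Y)) := sqrt_iterS B n.
have Vx x : V x = Y x + D x by rewrite e.
have bY : bounded_op Y by have [] := nnpoly_psd pB nY.
rewrite [X in _ = X + _]eV -scalerDr; congr (_ *: _).
rewrite -addrA; congr (_ + _); apply/funext => x.
by rewrite !opE /= [LHS]Vx {1}Vx bopD // addrA.
Qed.

Lemma sqrt_iter_nr B n x : psd B -> fbound 1 B -> nr (sqrt_iter B n x) <= nr x.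
Proof.
move=> pB fB; elim: n x => [|n ih] x; first by rewrite nr0 nr_ge0.
rewrite sqrt_iterS opE nrZ ger0_norm ?invr_ge0 // opE /=.
have := nrD (B x) (sqrt_iter B n (sqrt_iter B n x)).
have := ih x; have := ih (sqrt_iter B n x); have := psd_nr x pB ler01 fB.
rewrite mul1r /=; lra.
Qed.

(** With B = 1 - A the iterates increase to a solution of Y = (B + Y^2) / 2, and then (1 - Y)^2 = 1
    - B = A. As a strong limit of polynomials in B, Y commutes with all that commutes with A;
    uniqueness of roots rests on this clause. *)
Lemma exists_sqrt1 A : psd A -> fbound 1 A ->
  exists S, [/\ psd S, S \o S = A &
    forall Z, bounded_op Z -> comm Z A -> comm Z S].
Proof.
move=> pA fA; have [bA sA pA'] := pA.
have pB : psd (id - A).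
  by apply: psd_sub => //; [exact: psd_id | move=> x; rewrite rinxx -[X in _ <= X]mul1r].
have fB : fbound 1 (id - A).
  by move=> x; rewrite opE rinBl rinxx mul1r gerBl.
set B := id - A in pB fB; have [bB _ _] := pB.
have pY n : psd (sqrt_iter B n) by apply: (nnpoly_psd pB); exact: sqrt_iter_nnpoly.
have mono n : fle (sqrt_iter B n) (sqrt_iter B n.+1).
  move=> x; have [D [nD ->]] := sqrt_iter_step n pB.
  by rewrite opE rinDl lerDl; have [] := nnpoly_psd pB nD.
have bound n : fbound 1 (sqrt_iter B n).
  move=> x; apply: le_trans (rin_le _ _) _.
  by rewrite mul1r expr2 ler_wpM2r ?nr_ge0 // sqrt_iter_nr.
have [Y [pYl hY mY fY]] := monotone_sot ler01 pY mono bound.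
have [bY sY _] := pYl.
have YE x : Y x = (2^-1)%:C *: (B x + Y (Y x)).
  apply: (hcvg_unique (hcvg_shift (hY x))).
  apply: hcvgZ; apply: hcvgD; first exact: hcvg_cst.
  apply: (@hcvg_comp _ _ _ _ _ _ 1) => //; first by move=> n; have [] := pY n.
  by move=> n z; rewrite mul1r; exact: sqrt_iter_nr.
have YYE x : Y (Y x) = (2%:C) *: Y x - B x.
  by rewrite [X in _ *: X]YE scalerA -rmorphM divff ?pnatr_eq0 // scale1r addrAC subrr add0r.
exists (id - Y); split.
- apply: psd_sub => //; [exact: psd_id | move=> x].
  by rewrite rinxx -[X in _ <= X]mul1r.
- apply/funext => x /=; rewrite !opE bopB // YYE /B opE.
  by apply: rin_inj => z; rewrite !(rinBl, rinDl, rinNl, rinZl); ring.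
- move=> Z bZ cZ x; rewrite !opE bopB //; congr (_ - _).
  have cB : comm Z B by move=> y; rewrite /B !opE bopB // cZ.
  apply: (hcvg_unique (hcvg_op bZ (hY x))).
  have -> : (fun n => Z (sqrt_iter B n x)) = (fun n => sqrt_iter B n (Z x)).
    apply/funext => n; apply: (nnpoly_comm bZ cB); exact: sqrt_iter_nnpoly.
  exact: hY.
Qed.

Lemma exists_sqrt A : psd A ->
  exists S, [/\ psd S, S \o S = A &
    forall Z, bounded_op Z -> comm Z A -> comm Z S].
Proof.
move=> pA; have [c [c0 fc]] := psd_fbound pA.
have ci0 : 0 <= c^-1 by rewrite invr_ge0 ltW.
have [||S [pS SS cS]] := @exists_sqrt1 (c^-1%:C *: A); first exact: psd_scale.
  by move=> x; rewrite opE rinZl mul1r ler_pdivrMl.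
have [bS _ _] := pS.
have SE x : S (S x) = c^-1%:C *: A x by rewrite -[S (S x)]/((S \o S) x) SS.
exists ((Num.sqrt c)%:C *: S); split.
- by apply: psd_scale => //; exact: sqrtr_ge0.
- apply/funext => x /=; rewrite !opE bopZ // SE !scalerA -!rmorphM.
  by rewrite -expr2 sqr_sqrtr ?(ltW c0) // divff ?gt_eqF // scale1r.
- move=> Z bZ cZ x; rewrite !opE bopZ //; congr (_ *: _); apply: cS => // y.
  by rewrite !opE bopZ // cZ.
Qed.

(** Both roots are compared with the constructed root V. A root T commutes with its square, hence
    with V, so y = (T - V) x satisfies T y + V y = 0. Positivity gives T y = V y = 0, and |y|^2 =
    <x, (T - V) y> = 0. *)
Lemma sqrt_uniq S W : psd S -> psd W -> S \o S = W \o W -> S = W.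
Proof.
move=> pS pW e; have [bS sS _] := pS.
have [V [pV VV cV]] := exists_sqrt (psd_sq bS sS).
suff key T : psd T -> T \o T = V \o V -> T = V.
  have eW : W \o W = V \o V by rewrite VV.
  exact: etrans (key S pS (esym VV)) (esym (key W pW eW)).
move=> pT eT; have [bT sT pT'] := pT; have [bV sV pV'] := pV.
have eTx x : T (T x) = V (V x) by rewrite -[LHS]/((T \o T) x) eT.
have cTV : comm T V by apply: cV => // x; rewrite -VV -eT.
apply/funext => x; apply/eqP; rewrite -subr_eq0; apply/eqP.
set y := T x - V x.
have h0 : T y + V y = 0.
  rewrite /y (bopB _ _ bT) (bopB _ _ bV) eTx cTV.
  by apply: rin_inj => z; rewrite !(rinBl, rinDl, rin0l); ring.
have hT : T y = 0.
  apply: (psd_ker pT); apply/eqP; rewrite eq_le pT' andbT.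
  have := pV' y; have : rin (T y + V y) y = 0 by rewrite h0 rin0l.
  by rewrite rinDl; lra.
have hV : V y = 0 by move: h0; rewrite hT add0r.
by apply: rinxx_eq0; rewrite {1}/y rinBl sT sV hT hV !rin0r subrr.
Qed.

Lemma op_sqrtE S : psd S -> op_sqrt (S \o S) = S.
Proof.
move=> pS; rewrite /op_sqrt; case: xgetP => [W _ [/positive_opP pW e]|/(_ S)[]].
  exact: sqrt_uniq.
by split=> //; apply/positive_opP.
Qed.

Lemma op_sqrtP A : psd A -> psd (op_sqrt A) /\ op_sqrt A \o op_sqrt A = A.
Proof. by move=> /exists_sqrt[S [pS <- _]]; rewrite op_sqrtE. Qed.

Lemma sqrt_comm S Z : psd S -> bounded_op Z -> comm Z (S \o S) -> comm Z S.
Proof.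
move=> pS bZ h; have [bS sS _] := pS.
have [V [pV VV cV]] := exists_sqrt (psd_sq bS sS).
by rewrite (sqrt_uniq pS pV (esym VV)); exact: cV.
Qed.

End SquareRoot.

(** * Centered operators *)

Section PartialIsometry.
Variables (R : realType) (H : hilbertType R) (U U' : H -> H).
Hypotheses (piU : partial_isometry U) (aU : adj U U').
Implicit Types (x y z : H).

Let bU : bounded_op U := piU.1.
Let bU' : bounded_op U' := adj_bop bU aU.
Let aU' : adj U' U := adj_sym aU.

(** The kernel of U is stable under multiplication by i, so real orthogonality to it is complex
    orthogonality. *)
Lemma pi_isom x : (forall y, U y = 0 -> rin x y = 0) -> nr (U x) = nr x.
Proof.
move=> h; rewrite /nr (piU.2 x) // => y Uy; rewrite innerE !h //.
by rewrite bopZ // Uy scaler0.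
Qed.

Lemma pi_isom_adj y : nr (U (U' y)) = nr (U' y).
Proof. by apply: pi_isom => z Uz; rewrite aU' Uz rin0r. Qed.

(** Since |U x| = |x|, the square |U' U x - x|^2 equals |U' U x|^2 - |x|^2, and |U' U x| <= |x|. *)
Lemma pi_proj x : (forall y, U y = 0 -> rin x y = 0) -> U' (U x) = x.
Proof.
move=> /pi_isom h; apply/eqP; rewrite -subr_eq0; apply/eqP/nr_eq0.
apply/eqP; rewrite -[_ == 0](expf_eq0 _ 2) eq_le sqr_ge0 andbT nrB_sq aU' rinxx h.
have h1 : nr (U' (U x)) ^+ 2 <= nr x * nr (U' (U x)).
  by rewrite -rinxx aU'; apply: le_trans (rin_le _ _) _; rewrite h pi_isom_adj.
have := nr_ge0 x; have := nr_ge0 (U' (U x)); nra.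
Qed.

Lemma pi_adjK y : U' (U (U' y)) = U' y.
Proof. by apply: pi_proj => z Uz; rewrite aU' Uz rin0r. Qed.

Lemma pi_K x : U (U' (U x)) = U x.
Proof. by apply: rin_inj => z; rewrite aU aU' aU pi_adjK aU. Qed.

Lemma pi_adj_nr y : nr (U' y) <= nr y.
Proof.
have [->|n0] := eqVneq (nr (U' y)) 0; first exact: nr_ge0.
have p : 0 < nr (U' y) by rewrite lt_neqAle eq_sym n0 nr_ge0.
rewrite -(ler_pM2r p) -expr2 -rinxx aU'.
by apply: le_trans (rin_le _ _) _; rewrite pi_isom_adj.
Qed.

Lemma pi_nr x : nr (U x) <= nr x.
Proof.
have [->|n0] := eqVneq (nr (U x)) 0; first exact: nr_ge0.
have p : 0 < nr (U x) by rewrite lt_neqAle eq_sym n0 nr_ge0.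
rewrite -(ler_pM2r p) -expr2 -rinxx aU.
by apply: le_trans (rin_le _ _) _; rewrite ler_wpM2l ?nr_ge0 ?pi_adj_nr.
Qed.

Definition cphi (X : H -> H) : H -> H := U' \o X \o U.

Lemma cphiE X x : cphi X x = U' (X (U x)).
Proof. by []. Qed.

(** Write U as U U' U to the right of Y and move U U' to the left past Y. *)
Lemma cphi_mul X Y : comm (U \o U') Y -> cphi (X \o Y) = cphi X \o cphi Y.
Proof.
move=> h; have h' y : U (U' (Y y)) = Y (U (U' y)) := h y.
by apply/funext => x; rewrite /= !cphiE h' pi_K.
Qed.

Lemma psd_cphi X : psd X -> psd (cphi X).
Proof. by move=> pX; exact: psd_conj. Qed.

Lemma iter_cphiE k X x : iter k cphi X x = iter k U' (X (iter k U x)).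
Proof. by elim: k X x => // k ih X x; rewrite iterS cphiE ih iterS -iterSr. Qed.

Lemma comm_cphi X Y : comm (U \o U') X -> comm (U \o U') Y -> comm X Y ->
  comm (cphi X) (cphi Y).
Proof.
move=> cX cY cXY x.
rewrite -[LHS]/((cphi X \o cphi Y) x) -[RHS]/((cphi Y \o cphi X) x).
by rewrite -!cphi_mul // /cphi /= cXY.
Qed.

End PartialIsometry.

(** * Commutation relations of a centered operator *)

Section Centered.
Variables (R : realType) (H : hilbertType R) (T T' U U' P : H -> H).
Hypotheses (bT : bounded_op T) (aT : adj T T').
Hypotheses (piU : partial_isometry U) (aU : adj U U').
Hypotheses (pP : psd P) (PP : P \o P = T' \o T) (TE : T = U \o P).
Hypothesis kerU : forall x, U x = 0 <-> T x = 0.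
Implicit Types (x y z : H) (Z : H -> H).

Definition Qop m := iter m T' \o iter m T.
Hypothesis cenT : forall n m, (0 < n)%N -> (0 < m)%N ->
  comm (iter n T \o iter n T') (Qop m).

Let bU : bounded_op U := piU.1.
Let bU' : bounded_op U' := adj_bop bU aU.
Let aU' : adj U' U := adj_sym aU.
Let bT' : bounded_op T' := adj_bop bT aT.
Let bP : bounded_op P. Proof. by case: pP. Qed.
Let aP : adj P P. Proof. by case: pP. Qed.
Let TEx x : T x = U (P x). Proof. by rewrite TE. Qed.
Let PPx x : P (P x) = T' (T x). Proof. by rewrite -[LHS]/((P \o P) x) PP. Qed.
Let T'E x : T' x = P (U' x).
Proof. by apply: rin_inj => z; rewrite (adj_sym aT) TEx aP aU'. Qed.

Lemma ker_absE x : P x = 0 <-> U x = 0.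
Proof.
rewrite kerU TEx; split=> [->|]; first by rewrite bop0.
move=> h; apply: rinxx_eq0; rewrite aP PPx TEx h bop0 ?rin0r //.
Qed.

Lemma proj_abs x : U' (U (P x)) = P x.
Proof.
by apply: (pi_proj piU aU) => y /ker_absE Py; rewrite aP Py rin0r.
Qed.

Lemma bop_Qop m : bounded_op (Qop m).
Proof. by apply: bop_comp; exact: bop_iter. Qed.

Lemma adj_Qop m : adj (Qop m) (Qop m).
Proof. by apply: adj_comp; apply: adj_iter => //; exact: adj_sym. Qed.

Lemma QopD i j x : Qop (i + j) x = iter i T' (Qop j (iter i T x)).
Proof. by rewrite /Qop /= iterD [in iter (i + j) T x]addnC iterD. Qed.

(** For j = i + k both products have the outer factors T'^i and T^i; between them stand T^i T'^i and
    [Qop k], which commute by centeredness. *)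
Lemma comm_Qop i j : comm (Qop i) (Qop j).
Proof.
wlog ij : i j / (i <= j)%N => [h|].
  by case: (leqP i j) => [/h //|/ltnW /h h' x]; rewrite h'.
rewrite -(subnKC ij); move: (j - i)%N => k x.
(* Centeredness speaks of positive exponents only, so i = 0 and k = 0 are treated apart. *)
case: i {ij} => [|i]; first by [].
case: k => [|k]; first by rewrite addn0.
rewrite !QopD [in LHS]/Qop [in RHS]/Qop /=; congr (T' (iter i T' _)).
exact: (@cenT i.+1 k.+1 isT isT).
Qed.

Lemma comm_abs Z : bounded_op Z -> comm Z (Qop 1) -> comm Z P.
Proof. by move=> bZ h; apply: sqrt_comm => //; rewrite PP. Qed.

(** U U' is the projection onto the closure of the range of T T'. Its commutator with Z vanishes on
    the range and on the kernel of T T', so [cancel_op] applies. *)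
Lemma comm_range Z : bounded_op Z -> comm Z (T \o T') -> comm Z (U \o U').
Proof.
move=> bZ cZ x; apply/eqP; rewrite -subr_eq0; apply/eqP.
pose W := (Z \o (U \o U')) - ((U \o U') \o Z).
have bE : bounded_op (U \o U') by exact: bop_comp.
have bW : bounded_op W by apply: bop_sub; exact: bop_comp.
have [W' aW] := exists_adj bW.
have WE y : W y = Z (U (U' y)) - U (U' (Z y)) by [].
have ER y : U (U' (T (T' y))) = T (T' y) by rewrite !TEx (pi_K piU aU).
have cZ' y : Z (T (T' y)) = T (T' (Z y)) := cZ y.
have kR y : T (T' y) = 0 -> U (U' y) = 0.
  move=> h; apply/ker_absE; rewrite -T'E.
  by apply: rinxx_eq0; rewrite (adj_sym aT) h rin0r.
apply: (@cancel_op _ _ W W' (T \o T')) => // [|y|y Ry].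
- by apply: adj_comp => //; exact: adj_sym.
- by rewrite WE /= ER cZ' ER subrr.
- have Ry' : T (T' (Z y)) = 0 by rewrite -cZ' -[T (T' y)]/((T \o T') y) Ry bop0.
  by rewrite WE (kR _ Ry) (kR _ Ry') bop0 // subrr.
Qed.

Lemma comm_range_Qop m : comm (U \o U') (Qop m).
Proof.
case: m => // m x; apply/esym/comm_range; first exact: bop_Qop.
by move=> y; rewrite -(@cenT 1 m.+1).
Qed.

Lemma QopS m x : Qop m.+1 x = P (cphi U U' (Qop m) (P x)).
Proof. by rewrite -addn1 addnC QopD /= T'E TEx. Qed.

(* [P [P, F] P = 0], and P is injective on the ranges of P and F = [cphi (Qop m)]. *)
Lemma comm_abs_cphi m : comm P (cphi U U' (Qop m)).
Proof.
move=> x; apply/eqP; rewrite -subr_eq0; apply/eqP.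
set F := cphi U U' (Qop m).
have bF : bounded_op F.
  by apply: bop_comp => //; apply: bop_comp => //; exact: bop_Qop.
pose W := (P \o F) - (F \o P).
have WE y : W y = P (F y) - F (P y) by [].
have bW : bounded_op W by apply: bop_sub; exact: bop_comp.
have [W' aW] := exists_adj bW.
have cQ : comm (Qop m.+1) P by apply: comm_abs; [exact: bop_Qop | exact: comm_Qop].
apply: (@cancel_op _ _ W W' P) => // y; last first.
  move=> Py; have Uy := (ker_absE y).1 Py.
  by rewrite WE Py (bop0 bF) /F cphiE Uy (bop0 (bop_Qop m)) (bop0 bU') (bop0 bP) subr0.
set z := W (P y).
have zE : U' (U z) = z.
  by rewrite /z WE bopB // bopB // proj_abs /F !cphiE (pi_adjK piU aU).
have : P z = 0.
  by rewrite /z WE bopB // -!QopS cQ subrr.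
by move=> /ker_absE Uz; rewrite -zE Uz bop0.
Qed.

Lemma QopS_mul m : Qop m.+1 = cphi U U' (Qop m) \o Qop 1.
Proof. by apply/funext => x; rewrite QopS comm_abs_cphi PPx. Qed.

Let F k m := iter k (cphi U U') (Qop m).

Let bF k m : bounded_op (F k m).
Proof.
elim: k => [|k ih]; first exact: bop_Qop.
by apply: bop_comp => //; apply: bop_comp.
Qed.

(* Z commutes with [F k m.+1 = F k.+1 m \o F k 1] and with [F k 1], and the
   kernel of [F k 1] is contained in that of [F k.+1 m]; so [F k 1] can be
   cancelled. *)
Lemma comm_iter_cphi k :
  (forall m Z, bounded_op Z -> (forall n, comm Z (Qop n)) -> comm Z (F k m)) /\
  (forall m, F k m.+1 = F k.+1 m \o F k 1).
Proof.
elim: k => [|k [ihc ihm]].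
  by split=> [m Z _|m]; [exact | rewrite /F /= QopS_mul].
have bE : bounded_op (U \o U') by exact: bop_comp.
have aF : adj (F k 1) (F k 1).
  rewrite /F; elim: (k) => [|n ih]; first exact: adj_Qop.
  by move=> x y; rewrite iterS !cphiE aU' ih aU.
(* [F k 1] is U'^k P^2 U^k, so its form at x is |P U^k x|^2. If that vanishes then U^(k+1) x = 0,
   because P and U have the same kernel. *)
have kerF m x : F k 1 x = 0 -> F k.+1 m x = 0.
  move=> h; have : P (iter k U x) = 0.
    apply: rinxx_eq0; rewrite aP PPx.
    have aI : adj (iter k U) (iter k U') by exact: adj_iter.
    by rewrite aI -[T' (T _)]/(Qop 1 _) -iter_cphiE -/(F k 1 x) h rin0r.
  move=> /ker_absE; rewrite -iterS => Uk.
  rewrite /F iter_cphiE Uk !bop0 //; [exact: bop_iter | exact: bop_Qop].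
have comm' m Z : bounded_op Z -> (forall n, comm Z (Qop n)) -> comm Z (F k.+1 m).
  move=> bZ cZ x; apply/eqP; rewrite -subr_eq0; apply/eqP.
  pose W := (Z \o F k.+1 m) - (F k.+1 m \o Z).
  have WE y : W y = Z (F k.+1 m y) - F k.+1 m (Z y) by [].
  have bW : bounded_op W by apply: bop_sub; exact: bop_comp.
  have [W' aW] := exists_adj bW.
  have cF n : comm Z (F k n) by exact: ihc.
  apply: (@cancel_op _ _ W W' (F k 1)) => // y; rewrite WE.
    have FE z : F k.+1 m (F k 1 z) = F k m.+1 z by rewrite (ihm m).
    by rewrite cF !FE cF subrr.
  move=> Fy; rewrite (kerF _ y) // bop0 // kerF ?subrr //.
  by rewrite -cF Fy bop0.
split=> // m; rewrite {1}/F iterS -/(F k m.+1) (ihm m).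
rewrite (cphi_mul piU aU) //.
by apply: ihc => // n; exact: comm_range_Qop.
Qed.

End Centered.

(** * The power mean transform *)

Section Polar.
Variables (R : realType) (H : hilbertType R) (U U' : H -> H).
Hypotheses (piU : partial_isometry U) (aU : adj U U').
Implicit Types (x y z : H) (X Y : H -> H).

Let bU : bounded_op U := piU.1.
Let bU' : bounded_op U' := adj_bop bU aU.
Let aU' : adj U' U := adj_sym aU.

Lemma proj_right X : adj X X -> (forall x, U' (U (X x)) = X x) ->
  forall x, X (U' (U x)) = X x.
Proof. by move=> aX h x; apply: rin_inj => z; rewrite aX aU' aU h -aX. Qed.

Section Square.
Variable X : H -> H.
Hypotheses (pX : psd X) (projX : forall x, U' (U (X x)) = X x).
Hypothesis kerX : forall x, X x = 0 -> U x = 0.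

Let S := U \o (X \o X).
Let bX : bounded_op X. Proof. by case: pX. Qed.
Let aX : adj X X. Proof. by case: pX. Qed.
Let pXX : psd (X \o X). Proof. exact: psd_sq. Qed.

Lemma adjoint_polar : adjoint S = (X \o X) \o U'.
Proof.
apply: adjoint_eq; last by apply: adj_comp => //; exact: adj_comp.
by apply: bop_comp => //; exact: bop_comp.
Qed.

Lemma op_abs_polar : op_abs S = X \o X.
Proof.
rewrite /op_abs adjoint_polar.
have -> : ((X \o X) \o U') \o S = (X \o X) \o (X \o X); last exact: op_sqrtE.
by apply/funext => x; rewrite /S /= projX.
Qed.

Lemma ker_polar x : U x = 0 <-> S x = 0.
Proof.
rewrite /S /=; split=> h.
  by rewrite -(proj_right aX projX x) h !bop0.
apply: kerX; apply: rinxx_eq0; rewrite aX.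
by rewrite -(projX (X x)) h bop0 // rin0r.
Qed.

(** Uniqueness of the polar decomposition: two candidates agree on the range of X^2 and both vanish
    on its kernel. *)
Lemma polar_part_polar : polar_part S = U.
Proof.
rewrite /polar_part; case: xgetP => [V _|/(_ U)[]]; last first.
  by split=> //; [rewrite op_abs_polar | exact: ker_polar].
move=> [[bV _] SV kV]; rewrite op_abs_polar in SV.
have bW : bounded_op (V - U) by exact: bop_sub.
have [W' aW] := exists_adj bW.
have aXX : adj (X \o X) (X \o X) by case: pXX.
apply/funext => x; apply/eqP; rewrite -subr_eq0; apply/eqP.
apply: (@cancel_op _ _ (V - U) W' (X \o X)) => // y.
  by rewrite opBE -[V _]/((V \o (X \o X)) y) -SV subrr.
move=> Xy; have Sy : S y = 0 by rewrite /S /= -[X (X y)]/((X \o X) y) Xy bop0.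
by rewrite opBE ((kV y).2 Sy) ((ker_polar y).2 Sy) subrr.
Qed.

(** Put B = [cphi U U' X]. As U U' commutes with X, U B = X U; so the Duggal transform X^2 U is U
    B^2 and the Aluthge transform X U X is U B X. Since X and B commute, the weighted sum is the
    expansion of a square. *)
Lemma power_mean_polar (lambda : R) :
  comm (U \o U') X -> comm X (cphi U U' X) ->
  power_mean lambda S =
  let Y := (1 - lambda)%:C *: X + lambda%:C *: cphi U U' X in U \o (Y \o Y).
Proof.
move=> cE cX /=; rewrite /power_mean /duggal /aluthge op_abs_polar polar_part_polar.
rewrite (op_sqrtE pX); apply/funext => x.
have E y : U (U' (X y)) = X (U (U' y)) := cE y.
have cX' y : X (U' (X (U y))) = U' (X (U (X y))) := cX y.
have UB y : U (U' (X (U y))) = X (U y) by rewrite E (pi_K piU aU).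
rewrite !opE /= !opE !cphiE /S /=.
have lin := (fun x y => bopD x y bX, fun x y => bopD x y bU, fun x y => bopD x y bU',
  fun c x => bopZ c x bX, fun c x => bopZ c x bU, fun c x => bopZ c x bU').
rewrite !lin cX' !UB.
by apply: rin_inj => z; rewrite !(rinDl, rinZl); ring.
Qed.

End Square.
End Polar.

(** * Operator norms of the form U X^2 *)

Section OperatorNorm.
Variables (R : realType) (H : hilbertType R).
Implicit Types (x y z : H) (A X U : H -> H).

(** Here c is the least upper bound of the form of A on the unit ball and A <= X <= c. The upper
    estimate is |U X^2 x| = |X^2 x| <= c^2; the lower one is <A x, x> <= <X x, x> <= |X x| <= |X^2
    x|^(1/2) on the unit ball. It serves the iterates and their limit alike. *)
Lemma opnorm_sq_eq U U' A X c : adj U U' -> (forall x, U' (U (X x)) = X x) ->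
  psd X -> fle A X -> 0 <= c -> fbound c X ->
  (forall c', (forall x, nr x <= 1 -> rin (A x) x <= c') -> c <= c') ->
  opnorm (U \o (X \o X)) = c ^+ 2.
Proof.
move=> aU projX pX AX c0 Xc cmin; have [bX aX pX'] := pX.
rewrite /opnorm; set E := (Z in sup Z).
have ball1 x : (`|x| <= 1) = (nr x <= 1) by rewrite normE -lecR.
have nU x : nr (U (X (X x))) = nr (X (X x)).
  apply/eqP; rewrite -(@eqrXn2 _ 2) ?nr_ge0 // -!rinxx; apply/eqP.
  by rewrite aU projX.
have ub x : nr x <= 1 -> nr (U (X (X x))) <= c ^+ 2.
  move=> hx; rewrite nU; apply: le_trans (psd_nr _ pX c0 Xc) _.
  rewrite expr2 ler_wpM2l //; apply: le_trans (psd_nr _ pX c0 Xc) _.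
  by rewrite -[X in _ <= X]mulr1 ler_wpM2l.
have EE x : nr x <= 1 -> E (nr (U (X (X x)))).
  by move=> hx; exists x => //=; rewrite ball1.
have hE : has_sup E.
  split; first by exists (nr (U (X (X 0)))); apply: EE; rewrite nr0.
  by exists (c ^+ 2) => v [x /=]; rewrite ball1 => hx <-; exact: ub.
apply/eqP; rewrite eq_le; apply/andP; split.
  apply: ge_sup; first exact: hE.1.
  by move=> v [x /=]; rewrite ball1 => hx <-; exact: ub.
have s0 : 0 <= sup E.
  apply: (@le_trans _ _ (nr (U (X (X 0))))); first exact: nr_ge0.
  by apply: ub_le_sup; [exact: hE.2 | apply: EE; rewrite nr0].
rewrite -(sqr_sqrtr s0) ler_sqr ?nnegrE ?sqrtr_ge0 //.
apply: cmin => x hx; apply: le_trans (AX x) _.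
apply: (@le_trans _ _ (nr (X x))).
  by apply: le_trans (rin_le _ _) _; rewrite -[X in _ <= X]mulr1 ler_wpM2l ?nr_ge0.
rewrite -ler_sqr ?nnegrE ?nr_ge0 ?sqrtr_ge0 // sqr_sqrtr //.
apply: (@le_trans _ _ (nr (X (X x)))).
  rewrite -rinxx aX rinC; apply: le_trans (rin_le _ _) _.
  by rewrite -[X in _ <= X]mulr1 ler_wpM2l ?nr_ge0.
by rewrite -nU; apply: ub_le_sup; [exact: hE.2 | exact: EE].
Qed.

Lemma least_bound A : psd A -> exists c, [/\ 0 <= c, fbound c A &
  forall c', (forall x, nr x <= 1 -> rin (A x) x <= c') -> c <= c'].
Proof.
move=> pA; have [bA _ pA'] := pA; have [M [M0 hM]] := psd_fbound pA.
pose E := [set rin (A x) x | x in [set x : H | nr x <= 1]]%classic.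
have hE : has_sup E.
  split; first by exists (rin (A 0) 0), 0 => //=; rewrite nr0.
  exists M => _ [x /= hx <-]; apply: le_trans (hM x) _.
  by rewrite -[X in _ <= X]mulr1 ler_wpM2l ?(ltW M0) // expr_le1 ?nr_ge0.
have Ele x : nr x <= 1 -> rin (A x) x <= sup E.
  by move=> hx; apply: ub_le_sup; [exact: hE.2 | exists x].
exists (sup E); split.
- by apply: le_trans (Ele 0 _); rewrite ?rin0r ?nr0.
- move=> x; have [n0|n0] := eqVneq (nr x) 0.
    by rewrite (nr_eq0 n0) rin0r nr0 expr0n mulr0.
  have p : 0 < nr x by rewrite lt_neqAle eq_sym n0 nr_ge0.
  have := Ele ((nr x)^-1%:C *: x).
  rewrite nrZ ger0_norm ?invr_ge0 ?nr_ge0 // mulVf // lexx => /(_ isT).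
  rewrite bopZ // rinZl rinZr mulrA -expr2 exprVn ler_pdivrMl ?exprn_gt0 //.
  by rewrite mulrC.
- by move=> c' h; apply: ge_sup; [exact: hE.1 | move=> _ [x /= hx <-]; exact: h].
Qed.

End OperatorNorm.

Lemma comm_comp (R : realType) (H : hilbertType R) (Z X Y : H -> H) :
  comm Z X -> comm Z Y -> comm Z (X \o Y).
Proof. by move=> h h' x; rewrite /comp h h'. Qed.

Lemma comm_sym (R : realType) (H : hilbertType R) (X Y : H -> H) :
  comm X Y -> comm Y X.
Proof. by move=> h x; rewrite h. Qed.

(** * Square roots of the moduli of the iterates *)

Section Cone.
Variables (R : realType) (H : hilbertType R) (U U' A : H -> H).
Hypotheses (piU : partial_isometry U) (aU : adj U U') (pA : psd A).
Hypothesis kerA : forall x, U x = 0 -> A x = 0.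
Implicit Types (x y z : H) (X Y Z : H -> H).

Let bU : bounded_op U := piU.1.
Let bU' : bounded_op U' := adj_bop bU aU.
Let aU' : adj U' U := adj_sym aU.
Let phi := cphi U U'.
Let E := U \o U'.
Let bE : bounded_op E. Proof. exact: bop_comp. Qed.
Let D k := iter k phi A.

Lemma psd_iter_cphi k : psd (D k).
Proof. by elim: k => //= k ih; exact: psd_cphi. Qed.

Section Commutation.
Let A4 := (A \o A) \o (A \o A).
Hypothesis cE : forall k, comm E (iter k phi A4).
Hypothesis cA : forall k, comm A4 (iter k phi A4).

Let sq X : psd X -> psd (X \o X).
Proof. by move=> [bX aX _]; exact: psd_sq. Qed.

Let fourth X Z : psd X -> bounded_op Z -> comm Z ((X \o X) \o (X \o X)) -> comm Z X.
Proof. by move=> pX bZ h; do 2![apply: sqrt_comm => //]; exact: sq. Qed.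

(** Centeredness gives relations for phi^k(A^4), and they pass to fourth roots. The two claims are
    proved together: multiplicativity of phi at stage k needs E to commute with [D k], and the root
    at stage k + 1 needs phi^(k+1)(A^4) = phi^(k+1)(A)^4. *)
Lemma iter_cphi_fourth k :
  comm E (D k) /\ iter k phi A4 = (D k \o D k) \o (D k \o D k).
Proof.
elim: k => [|k [ihE ih4]]; first by split=> //; apply: fourth => //; exact: (cE 0).
have cEsq : comm E (D k \o D k).
  exact: comm_comp.
have e : iter k.+1 phi A4 = (D k.+1 \o D k.+1) \o (D k.+1 \o D k.+1).
  rewrite iterS ih4 /phi (cphi_mul piU aU _ cEsq) (cphi_mul piU aU _ ihE).
  by [].
split=> //; apply: fourth => //; first exact: psd_iter_cphi.
by rewrite -e; exact: cE.
Qed.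

(** Applying phi to a commuting pair reduces the claim to i = 0, where fourth roots are taken in one
    argument and then in the other. *)
Lemma comm_iter_cphi_fourth i j : comm (D i) (D j).
Proof.
wlog ij : i j / (i <= j)%N => [h|].
  by case: (leqP i j) => [/h //|/ltnW /h /comm_sym].
rewrite -(subnKC ij); move: (j - i)%N => k {ij j}.
elim: i => [|i ih]; last first.
  by apply: (comm_cphi piU aU) => //; [exact: (iter_cphi_fourth _).1 ..].
apply: comm_sym; apply: fourth => //; first by have [] := psd_iter_cphi k.
apply: comm_sym; apply: fourth.
- exact: psd_iter_cphi.
- by have [] := sq (sq pA).
- by rewrite -(iter_cphi_fourth k).2; exact: cA.
Qed.

End Commutation.

(* The transform sends [U X^2] to [U Y^2] with Y = (1 - lambda) X + lambda
   [cphi X], so starting from A the square roots of the moduli of the iterates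
   stay in this cone. *)
Inductive cone : (H -> H) -> Prop :=
| cone_gen k : cone (D k)
| cone_comb r s X Y : 0 <= r -> 0 <= s -> cone X -> cone Y ->
    cone (r%:C *: X + s%:C *: Y).

Lemma cone_psd X : cone X -> psd X.
Proof.
elim=> [k|r s Y Z r0 s0 _ pY _ pZ]; first exact: psd_iter_cphi.
by apply: psd_add; exact: psd_scale.
Qed.

Lemma cone_cphi X : cone X -> cone (phi X).
Proof.
elim=> [k|r s Y Z r0 s0 _ pY _ pZ]; first exact: (cone_gen k.+1).
have -> : phi (r%:C *: Y + s%:C *: Z) = r%:C *: phi Y + s%:C *: phi Z.
  by apply/funext => x; rewrite /phi !opE !cphiE !opE (bopD _ _ bU') !(bopZ _ _ bU').
exact: cone_comb.
Qed.

Lemma cone_proj X : cone X -> forall x, U' (U (X x)) = X x.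
Proof.
elim=> [k|r s Y Z r0 s0 _ pY _ pZ] x; last first.
  by rewrite !opE (bopD _ _ bU) !(bopZ _ _ bU) (bopD _ _ bU') !(bopZ _ _ bU') pY pZ.
case: k => [|k]; last by rewrite /D iterS /phi cphiE (pi_adjK piU aU).
apply: (pi_proj piU aU) => y /kerA Ay.
by have [_ aA _] := pA; rewrite aA Ay rin0r.
Qed.

Lemma cone_comm_left Z X : bounded_op Z -> (forall k, comm Z (D k)) -> cone X ->
  comm Z X.
Proof.
move=> bZ h; elim=> [//|r s Y V r0 s0 _ cY _ cV] x.
by rewrite !opE (bopD _ _ bZ) !(bopZ _ _ bZ) cY cV.
Qed.

Lemma cone_comm X Y : (forall i j, comm (D i) (D j)) -> cone X -> cone Y -> comm X Y.
Proof.
move=> h cX cY; have [bX _ _] := cone_psd cX; have [bY _ _] := cone_psd cY.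
apply: cone_comm_left => // k x; apply/esym/cone_comm_left => //.
by have [] := psd_iter_cphi k.
Qed.

Section Iteration.
Variable lambda : R.
Hypothesis lambda01 : 0 < lambda < 1.
Hypothesis cE : forall k, comm E (D k).
Hypothesis cD : forall i j, comm (D i) (D j).
Hypothesis hypo : fle A (phi A).

Let l0 : 0 <= lambda. Proof. by have /andP[/ltW] := lambda01. Qed.
Let l1 : 0 <= 1 - lambda. Proof. by have /andP[_ /ltW] := lambda01; rewrite subr_ge0. Qed.

Let step X := (1 - lambda)%:C *: X + lambda%:C *: phi X.

Definition pm_iter n := iter n step A.

Lemma pm_iter_cone n : cone (pm_iter n).
Proof.
elim: n => [|n ih]; first exact: (cone_gen 0).
by apply: cone_comb => //; exact: cone_cphi.
Qed.

Let rphi X x : rin (phi X x) x = rin (X (U x)) (U x).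
Proof. by rewrite /phi cphiE aU'. Qed.

Let rstep X x :
  rin (step X x) x = (1 - lambda) * rin (X x) x + lambda * rin (phi X x) x.
Proof. by rewrite /step !opE rinDl !rinZl. Qed.

(** The inequality X <= phi(X) survives a step because phi is linear and preserves the order. *)
Lemma pm_iter_cphi n : fle (pm_iter n) (phi (pm_iter n)).
Proof.
elim: n => // n ih x; rewrite rphi /pm_iter iterS -/(pm_iter n) !rstep.
apply: lerD; apply: ler_wpM2l => //; first by rewrite -rphi; exact: ih.
by rewrite [rin (phi _ x) x]rphi; exact: ih.
Qed.

Lemma pm_iter_mono n : fle (pm_iter n) (pm_iter n.+1).
Proof.
move=> x; rewrite /pm_iter iterS -/(pm_iter n) rstep.
have := ler_wpM2l l0 (pm_iter_cphi n x); lra.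
Qed.

Lemma pm_iter_ge n : fle A (pm_iter n).
Proof. by elim: n => [//|n ih] x; apply: le_trans (ih x) (pm_iter_mono n x). Qed.

Lemma pm_iter_bound c n : 0 <= c -> fbound c A -> fbound c (pm_iter n).
Proof.
move=> c0 hA; elim: n => // n ih x; rewrite /pm_iter iterS -/(pm_iter n) rstep.
have h : rin (phi (pm_iter n) x) x <= c * nr x ^+ 2.
  rewrite rphi; apply: le_trans (ih _) _; rewrite ler_wpM2l //.
  by rewrite ler_sqr ?nnegrE ?nr_ge0 // (pi_nr piU aU).
have := ler_wpM2l l0 h; have := ler_wpM2l l1 (ih x); lra.
Qed.

Hypothesis kerU : forall x, A x = 0 -> U x = 0.

(** As A <= A_n, the kernel cannot grow along the iteration; this keeps U the polar part of every
    iterate. *)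
Lemma pm_iter_ker n x : pm_iter n x = 0 -> U x = 0.
Proof.
move=> h; apply: kerU; apply: (psd_ker pA); apply/eqP; rewrite eq_le.
have [_ _ -> ] := pA; rewrite andbT.
by apply: le_trans (pm_iter_ge n x) _; rewrite h rin0l.
Qed.

Lemma iter_power_mean n :
  iter n (power_mean lambda) (U \o (A \o A)) = U \o (pm_iter n \o pm_iter n).
Proof.
elim: n => // n ih; have cn := pm_iter_cone n.
rewrite iterS ih (power_mean_polar piU aU (cone_psd cn)) //.
- exact: cone_proj.
- exact: pm_iter_ker.
- exact: cone_comm_left.
- by apply: cone_comm => //; exact: cone_cphi.
Qed.

(** Passing to the limit in the recursion gives Y = (1 - lambda) Y + lambda phi(Y), so phi(Y) = Y as
    lambda > 0. Also U U' commutes with Y, hence U Y = U U' Y U = Y U U' U = Y U. *)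
Lemma pm_iter_limit c : 0 <= c -> fbound c A ->
  exists Y, [/\ psd Y, forall x, hcvg (fun n => pm_iter n x) (Y x),
    fle A Y, fbound c Y & (forall x, U' (U (Y x)) = Y x) /\ comm U Y].
Proof.
move=> c0 hA.
have [Y [pY hY mY fY]] := monotone_sot c0 (fun n => cone_psd (pm_iter_cone n))
  pm_iter_mono (fun n => pm_iter_bound n c0 hA).
have [bY aY _] := pY.
have YE x : U' (Y (U x)) = Y x.
  have e : Y x = (1 - lambda)%:C *: Y x + lambda%:C *: U' (Y (U x)).
    apply: (hcvg_unique (hcvg_shift (hY x))).
    have -> : (fun n => pm_iter n.+1 x) =
       (fun n => (1 - lambda)%:C *: pm_iter n x + lambda%:C *: U' (pm_iter n (U x))) by [].
    by apply: hcvgD; apply: hcvgZ => //; exact: hcvg_op.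
  apply: rin_inj => z; have /(congr1 (fun v => rin v z)) := e.
  rewrite rinDl !rinZl => h.
  have {}h : lambda * rin (U' (Y (U x))) z = lambda * rin (Y x) z by lra.
  by have /andP[lp _] := lambda01; apply: (mulfI _ h); rewrite gt_eqF.
have EY x : U (U' (Y x)) = Y (U (U' x)).
  apply: (hcvg_unique _ (hY _)).
  have -> : (fun n => pm_iter n (U (U' x))) = (fun n => E (pm_iter n x)).
    by apply/funext => n; rewrite (cone_comm_left bE cE (pm_iter_cone n)).
  exact: hcvg_op.
exists Y; split => //; first by move=> x; exact: (mY 0%N).
split=> x; first by rewrite -YE (pi_adjK piU aU).
by rewrite -[in LHS]YE EY (pi_K piU aU).
Qed.

End Iteration.
End Cone.

(** * Centered semi-hyponormal operators *)

Theorem theorem3p18 (R : realType) (H : hilbertType R) (T U : H -> H)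
    (lambda : R) :
  bounded_op T -> centered T -> polar_decomposition T U ->
  0 < lambda < 1 ->
  semi_hyponormal T ->
  exists L : H -> H,
    [/\ positive_op L,
        sot_cvg (fun n => iter n (power_mean lambda) T) (U \o L),
        quasinormal (U \o L) &
        forall n : nat, opnorm (U \o L) = opnorm (iter n (power_mean lambda) T)].
Proof.
move=> bT cenT [piU TE kerU] lambda01 hypT.
have aT := adjointP bT; set T' := adjoint T in aT.
have bT' : bounded_op T' := bop_adjoint bT.
have [U' aU] := exists_adj piU.1.
have bU := piU.1; have bU' := adj_bop bU aU; have aU' := adj_sym aU.
have pTT : psd (T' \o T).
  by split=> [|| x /=]; [exact: bop_comp | apply: adj_comp => //; exact: adj_sym
    | rewrite (adj_sym aT) rinxx_ge0].
have [pP PP] := op_sqrtP pTT.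
have [pA AA] := op_sqrtP pP.
rewrite -/(op_abs T) in pP PP pA AA.
set P := op_abs T in TE pP PP pA AA; set A := op_sqrt P in pA AA.
have [bP aP _] := pP; have [bA aA pA'] := pA.
have AAx x : A (A x) = P x by rewrite -AA.
have kerPU x : P x = 0 <-> U x = 0 := ker_absE bT aT piU pP PP TE kerU x.
have kerA x : U x = 0 -> A x = 0.
  by move=> /kerPU Px; apply: rinxx_eq0; rewrite aA AAx Px rin0r.
have kerU' x : A x = 0 -> U x = 0.
  by move=> Ax; apply/kerPU; rewrite -AAx Ax bop0.
have cen n m : (0 < n)%N -> (0 < m)%N -> comm (iter n T \o iter n T') (Qop T T' m).
  move=> n0 m0 x; have := cenT n m n0 m0.
  rewrite !(adjoint_eq (bop_iter _ bT) (adj_iter _ aT)) => /(congr1 (fun f => f x)).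
  by rewrite /commutator opBE op0E => /eqP; rewrite subr_eq0 => /eqP.
have Q1 : Qop T T' 1 = (A \o A) \o (A \o A) by rewrite AA PP.
have cQ := comm_iter_cphi bT aT piU aU pP PP TE kerU cen.
have cE4 k : comm (U \o U') (iter k (cphi U U') ((A \o A) \o (A \o A))).
  rewrite -Q1; apply: (cQ k).1 => [|n]; first exact: bop_comp.
  exact: (comm_range_Qop bT aT piU aU pP PP TE kerU cen).
have cA4 k : comm ((A \o A) \o (A \o A)) (iter k (cphi U U') ((A \o A) \o (A \o A))).
  rewrite -Q1; apply: (cQ k).1 => [|n]; first exact: bop_Qop.
  exact: (comm_Qop cen).
have cE k := (iter_cphi_fourth piU aU pA cE4 k).1.
have cD := comm_iter_cphi_fourth piU aU pA cE4 cA4.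
have projP := proj_abs bT aT piU aU pP PP TE kerU.
(* The modulus of the adjoint is U P U', a positive operator whose square is T T'. *)
have absT' : op_sqrt (T \o T') = (U \o P) \o U'.
  have -> : T \o T' = ((U \o P) \o U') \o ((U \o P) \o U').
    have -> : T' = P \o U'.
      by apply: (adj_uniq aT); rewrite TE; exact: adj_comp.
    by apply/funext => x; rewrite TE /= projP.
  by apply: op_sqrtE; exact: (psd_conj pP bU').
have hypUx : psd (P - ((U \o P) \o U')).
  by apply/positive_opP; rewrite -absT'; exact: hypT.
(* Testing U P U' <= P on vectors U x gives <P x, x> <= <P (U x), U x>. The sides are |A x|^2 and
   |phi(A) x|^2, since phi(A)^2 = phi(P), and Loewner-Heinz takes the roots. *)
have hypo : fle A (cphi U U' A).
  apply: loewner_heinz => //; first exact: psd_cphi.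
  move=> x; rewrite -ler_sqr ?nnegrE ?nr_ge0 // -!rinxx.
  have EA z : U (U' (A z)) = A (U (U' z)) := cE 0%N z.
  have -> : rin (cphi U U' A x) (cphi U U' A x) = rin (P (U x)) (U x).
    by rewrite !cphiE aU' EA (pi_K piU aU) -aA AAx.
  rewrite -aA AAx; have [_ _ /(_ (U x))] := hypUx.
  rewrite opBE rinBl subr_ge0 /= aU (proj_right aU aP projP).
  by rewrite aP (proj_right aU aP projP) -aP.
have TAA : T = U \o (A \o A) by rewrite AA.
have [c [c0 hA cmin]] := least_bound pA.
have [Y [pY hY AY Yc [projY UY]]] :=
  pm_iter_limit piU aU pA lambda01 cE hypo c0 hA.
have [bY aY _] := pY.
have itE n := iter_power_mean piU aU pA kerA lambda01 cE cD hypo kerU' n.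
exists (Y \o Y); split.
- exact/positive_opP/psd_sq.
- move=> x; apply/hcvgP; rewrite TAA.
  have -> : (fun n => iter n (power_mean lambda) (U \o (A \o A)) x) =
      (fun n => U (pm_iter U U' A lambda n (pm_iter U U' A lambda n x))).
    by apply/funext => n; rewrite itE.
  have cn n := cone_psd piU aU pA (pm_iter_cone A piU aU lambda01 n).
  apply: (hcvg_op bU); apply: (@hcvg_comp _ _ (pm_iter U U' A lambda) Y _ _ c).
  + by move=> n; have [] := cn n.
  + by move=> n z; apply: psd_nr => //; exact: (pm_iter_bound piU aU lambda01 n c0 hA).
  + exact: hY.
  + exact: hY.
(* The modulus squared of U Y^2 is Y^4, which commutes with U Y^2 because U Y = Y U. *)
- rewrite /quasinormal (adjoint_polar piU aU pY).
  apply/funext => x; rewrite /commutator opBE op0E /= !projY.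
  by rewrite -!(UY _) subrr.
(* Both norms equal c^2, with c the least bound of A. *)
- move=> n; rewrite TAA itE.
  rewrite (opnorm_sq_eq aU projY pY AY c0 Yc cmin).
  have cn := pm_iter_cone A piU aU lambda01 n.
  rewrite (opnorm_sq_eq aU _ (cone_psd piU aU pA cn) _ c0 _ cmin) //.
  + exact: (cone_proj piU aU pA kerA cn).
  + exact: (pm_iter_ge aU lambda01 hypo).
  + exact: (pm_iter_bound piU aU lambda01 n c0 hA).
Qed.
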